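(* Let $X$ be a semi-Kelley arc continuum. Then $X$ is a semi-Kelley remainder.
   Context: A continuum is a compact connected metric space with more than one point. A subcontinuum of a continuum $X$ is a non-empty compact connected subset of $X$ (one-point sets are allowed). Convergence of subcontinua is with respect to the Hausdorff metric. An arc is a space homeomorphic to $[0,1]$. An arc continuum is a continuum all of whose proper subcontinua with more than one point are arcs. A compactification of $(0,1]$ with remainder $R$ is a continuum $Y=(0,1]\cup R$, where $(0,1]$ (a subspace homeomorphic to the half-open interval) is dense in $Y$ and $R$ and $(0,1]$ are disjoint. A continuum $X$ is a semi-Kelley remainder if it is (up to homeomorphism) the remainder of some compactification of $(0,1]$ which is a semi-Kelley continuum. Let $K$ be a subcontinuum of a continuum $Z$. A maximal limit continuum of $K$ is a subcontinuum $M\subset K$ for which there is a sequence $\{M_n\}_{n=1}^\infty$ of subcontinua of $Z$ converging to $M$ such that for each convergent sequence $\{M_n'\}_{n=1}^\infty$ of subcontinua of $Z$ with $M_n\subset M_n'$ for each $n\in\mathbb N$ and $\lim M_n'=M'\subset K$, we have $M'=M$. A continuum $Z$ is semi-Kelley if for each subcontinuum $K$ of $Z$ and every two maximal limit continua $L$ and $M$ of $K$, either $L\subset M$ or $M\subset L$. *)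

(* Defs.v *)
From HB Require Import structures.
From mathcomp Require Import all_boot all_order all_algebra.
From mathcomp Require Import all_classical all_reals all_analysis.

Set Implicit Arguments.
Unset Strict Implicit.
Unset Printing Implicit Defensive.

Import Order.TTheory GRing.Theory Num.Theory.
Import numFieldTopology.Exports numFieldNormedType.Exports.

Local Open Scope classical_set_scope.
Local Open Scope ring_scope.

Definition homeomorphic (S T : topologicalType) : Prop :=
  exists (f : S -> T) (g : T -> S),
    [/\ cancel f g, cancel g f, continuous f & continuous g].

Definition continuum (R : realType) (X : metricType R) : Prop :=
  [/\ compact [set: X], connected [set: X] & exists x y : X, x <> y].

Definition subcontinuum (R : realType) (Z : metricType R) (K : set Z) : Prop :=
  [/\ K !=set0, compact K & connected K].

Definition is_arc (R : realType) (T : topologicalType) : Prop :=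
  homeomorphic T (set_type (`[0, 1]%classic : set R)).

Definition arc_continuum (R : realType) (X : metricType R) : Prop :=
  continuum X /\
  forall K : set X, subcontinuum K -> K <> [set: X] ->
    (exists x y : X, [/\ K x, K y & x <> y]) -> is_arc R (set_type K).

Definition set_nbhd (R : realType) (Z : metricType R) (e : R) (A : set Z) :
  set Z := \bigcup_(a in A) ball a e.

(* The infimum is taken over a nonempty set as soon as A and B are nonempty and
   bounded; [inf set0] is 0, so this is meaningless for other arguments. *)
Definition hausdorff_dist (R : realType) (Z : metricType R) (A B : set Z) : R :=
  inf [set e : R | [/\ 0 < e, A `<=` set_nbhd e B & B `<=` set_nbhd e A]].

Definition hausdorff_cvg (R : realType) (Z : metricType R)
    (M_ : nat -> set Z) (M : set Z) : Prop :=
  hausdorff_dist (M_ n) M @[n --> \oo] --> (0 : R).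

Definition maximal_limit_continuum (R : realType) (Z : metricType R)
    (K M : set Z) : Prop :=
  [/\ subcontinuum M, M `<=` K &
  exists M_ : nat -> set Z,
  [/\ forall n, subcontinuum (M_ n),
      hausdorff_cvg M_ M &
      forall (M'_ : nat -> set Z) (M' : set Z),
        (forall n, subcontinuum (M'_ n)) -> subcontinuum M' ->
        hausdorff_cvg M'_ M' ->
        (forall n, M_ n `<=` M'_ n) -> M' `<=` K -> M' = M]].

Definition semi_Kelley (R : realType) (Z : metricType R) : Prop :=
  continuum Z /\
  forall K : set Z, subcontinuum K ->
  forall L M : set Z,
    maximal_limit_continuum K L -> maximal_limit_continuum K M ->
    L `<=` M \/ M `<=` L.

Definition compactification_with_remainder (R : realType) (Y : metricType R)
    (Q : set Y) : Prop :=
  continuum Y /\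
  exists P : set Y,
    [/\ homeomorphic (set_type P) (set_type (`]0, 1]%classic : set R)),
        dense P, P `&` Q = set0 & P `|` Q = [set: Y]].

Definition semi_Kelley_remainder (R : realType) (X : metricType R) : Prop :=
  exists (Y : metricType R) (Q : set Y),
    [/\ compactification_with_remainder Q, semi_Kelley Y &
        homeomorphic X (set_type Q)].

(* Main.v *)
(* The idea is to find a map phi : R -> X all of whose tails phi [T, oo[ are
   dense and such that any proper subcontinuum A containing phi [a, b] is
   itself an image phi [c, d] with c <= a and b <= d.  Then
   Y = X x {0} U {(phi (1/s), s) | 0 < s <= 1} is the required
   compactification.  A subcontinuum K of Y which is a full slab of heights
   [a, b] has K as its only maximal limit continuum, because a sequence of
   continua tending to a part of K can be enlarged to slabs tending to K.  Any
   other K is A x {0} for a proper subcontinuum A of X, and the lifting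
   property turns a maximal limit continuum of K in Y into one of A in X,
   where semi_Kelley X applies.

   If X is a union of two proper subcontinua, it is an arc or a circle, and phi
   runs back and forth, respectively around, X forever.  Otherwise a composant
   of X is the union of an increasing sequence of arcs, hence a continuous
   image of R; it is dense by boundary bumping, and since X is indecomposable
   all the tails of one of its two sides are dense. *)

Require Import Defs.
From HB Require Import structures.
From mathcomp Require Import all_boot all_order all_algebra.
From mathcomp Require Import all_classical all_reals all_analysis.
From mathcomp Require Import lra zify.

Set Implicit Arguments.
Unset Strict Implicit.
Unset Printing Implicit Defensive.

Import Order.TTheory GRing.Theory Num.Theory.
Import numFieldTopology.Exports numFieldNormedType.Exports.

Local Open Scope classical_set_scope.
Local Open Scope ring_scope.

(** * Metric continua and Hausdorff convergence *)

Section metric_facts.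
Context {R : realType}.

(** The obstacle is the passage from [Y] down to [X]. Maximality in [X] is tested on arbitrary
    continua [N_ n] containing the projections of [M_ n], whereas maximality of [L] only speaks of
    continua of [Y], and those that leave the base are full slabs. The lifting property converts
    [N_ n] into a continuum of [Y] containing [M_ n]. Such a lift can fail to cover [N_ n] only by
    reaching the top of the ray, and in the limit no lift stays tall: together with points near the
    base it would contain a long piece of the ray, and the density of the tails would make [K]
    project onto [X]. For lifting it is enough that the preimage of [A] in a suitable bounded window
    of parameters is an interval, and this follows by connectedness of [A] when its fibers in the
    window are intervals. Intervals and not points, because one-point continua have constant paths
    and an arc that is extended at one end only has to wait at the other. That the decomposable case
    gives nothing but an arc or a circle comes from the absence of triods: three proper continua
    through one point with a proper union lie in an arc. *)

Lemma ball_mdist (X : metricType R) (x y : X) (e : R) :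
  ball x e y <-> mdist x y < e.
Proof. by rewrite ballEmdist. Qed.

Lemma mdist_continuous (X : metricType R) (x : X) :
  continuous (fun y => mdist x y : R).
Proof.
move=> y; apply/cvgrPdist_lt => e e0; near=> z.
have : mdist y z < e by apply/ball_mdist; near: z; exact: nbhsx_ballx.
have := metric_triangle x y z; have := metric_triangle x z y.
rewrite (metric_sym z y) => h1 h2 h3.
by rewrite ltr_norml; apply/andP; split; lra.
Unshelve. all: by end_near. Qed.

Lemma lipschitz_continuous (Y Z : metricType R) (f : Y -> Z) :
  (forall x y, mdist (f x) (f y) <= mdist x y) -> continuous f.
Proof.
move=> fL x U; rewrite -nbhs_ballE => -[e /= e0 eU].
rewrite nbhs_simpl /=; near=> z; apply: eU; apply/ball_mdist.
apply: le_lt_trans (fL _ _) _; apply/ball_mdist.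
by near: z; exact: nbhsx_ballx.
Unshelve. all: by end_near. Qed.

Lemma lipschitz_continuous_real (Z : metricType R) (f : Z -> R) :
  (forall x y, `|f x - f y| <= mdist x y) -> continuous f.
Proof.
move=> fL x; apply/cvgrPdist_lt => e e0; near=> z.
apply: le_lt_trans (fL _ _) _; apply/ball_mdist.
by near: z; exact: nbhsx_ballx.
Unshelve. all: by end_near. Qed.

Lemma set_nbhd_open (X : metricType R) (e : R) (A : set X) :
  open (set_nbhd e A).
Proof.
rewrite openE => y [x Ax /ball_mdist xy]; rewrite /interior -nbhs_ballE.
exists (e - mdist x y) => /=; first by rewrite subr_gt0.
move=> z /ball_mdist yz; exists x => //; apply/ball_mdist.
by have := metric_triangle x y z; lra.
Qed.

Lemma sub_set_nbhd (X : metricType R) (e : R) (A : set X) :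
  0 < e -> A `<=` set_nbhd e A.
Proof. by move=> e0 x Ax; exists x => //; exact: ballxx. Qed.

Lemma compact_metric_closed (X : metricType R) (K : set X) :
  compact K -> closed K.
Proof. by apply: compact_closed; exact: metric_hausdorff. Qed.

Lemma subcontinuumP (X : metricType R) (K : set X) : compact [set: X] ->
  subcontinuum K <-> [/\ K !=set0, closed K & connected K].
Proof.
move=> cX; split=> -[K0 cK kK]; split=> //; first exact: compact_metric_closed.
exact: subclosed_compact cX _.
Qed.

Lemma compact_mdist_bounded (X : metricType R) : compact [set: X] ->
  exists2 D : R, 0 < D & forall x y : X, mdist x y < D.
Proof.
move=> cX; have [[x0 _]|/nonemptyPn X0] := pselect ([set: X] !=set0); last first.
  by exists 1 => // x; have : [set: X] x by []; rewrite X0.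
have /compact_bounded : compact ((fun y => mdist x0 y : R) @` [set: X]).
  by apply: continuous_compact => //; apply/continuous_subspaceT/mdist_continuous.
move=> [M [_ HM]].
have Mb y : mdist x0 y <= `|M| + 1.
  have HM1 : M < `|M| + 1 by have := ler_norm M; lra.
  have /= := HM _ HM1 (mdist x0 y).
  by rewrite ger0_norm ?mdist_ge0//; apply; exists y.
exists ((`|M| + 1) + (`|M| + 1) + 1) => [|x y].
  by have := normr_ge0 M; lra.
have := metric_triangle x x0 y; rewrite (metric_sym x x0).
by have := Mb x; have := Mb y; lra.
Qed.

Lemma hausdorff_cvgP (X : metricType R) (M_ : nat -> set X) (M : set X) :
  compact [set: X] -> (forall n, M_ n !=set0) -> M !=set0 ->
  hausdorff_cvg M_ M <-> forall e : R, 0 < e ->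
    \forall n \near \oo, M_ n `<=` set_nbhd e M /\ M `<=` set_nbhd e (M_ n).
Proof.
move=> cX Mn0 M0; have [D D0 HD] := compact_mdist_bounded cX.
pose S n := [set e : R | [/\ 0 < e, M_ n `<=` set_nbhd e M
  & M `<=` set_nbhd e (M_ n)]].
(* The bound [D] on all distances is an admissible radius, so [inf (S n)] is a genuine infimum and
   not the default value of [inf set0]. *)
have S0 n : S n !=set0.
  exists D; split=> // x Mx.
  - by have [y My] := M0; exists y => //; apply/ball_mdist.
  - by have [y My] := Mn0 n; exists y => //; apply/ball_mdist.
have lS n : lbound (S n) 0 by move=> e [/ltW].
have infS n : 0 <= inf (S n) by exact: lb_le_inf.
have hiS n : has_lbound (S n) by exists 0.
split=> [/cvgrPdist_lt MM e e0|MM].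
  near=> n; have : hausdorff_dist (M_ n) M < e.
    have : `|0 - hausdorff_dist (M_ n) M| < e by near: n; exact: MM.
    by rewrite sub0r normrN ger0_norm// infS.
  rewrite /hausdorff_dist -/(S n) => /(inf_lt (S0 n))[d [d0 dM1 dM2] de].
  split=> x.
  - by move=> /dM1[y My xy]; exists y => //; apply: le_ball xy; exact: ltW.
  - by move=> /dM2[y My xy]; exists y => //; apply: le_ball xy; exact: ltW.
apply/cvgrPdist_lt => e e0; have e20 : 0 < e / 2 by lra.
have {}MM := MM _ e20; near=> n.
rewrite sub0r normrN ger0_norm ?infS//.
apply: (@le_lt_trans _ _ (e / 2)); last lra.
apply: (ge_inf (hiS n)).
have [? ?] : M_ n `<=` set_nbhd (e / 2) M /\ M `<=` set_nbhd (e / 2) (M_ n).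
  by near: n.
by split.
Unshelve. all: by end_near. Qed.

Lemma subcontinuum_cvgP (X : metricType R) (M_ : nat -> set X) (M : set X) :
  compact [set: X] -> (forall n, subcontinuum (M_ n)) -> subcontinuum M ->
  hausdorff_cvg M_ M <-> forall e : R, 0 < e ->
    \forall n \near \oo, M_ n `<=` set_nbhd e M /\ M `<=` set_nbhd e (M_ n).
Proof.
by move=> cX sM_ [M0 _ _]; apply: hausdorff_cvgP => // n; case: (sM_ n).
Qed.

(** Without a common point in [K], the trace of [A] on [K] would be open and closed in [K], hence
    equal to [K], against the point of [K] in [B]. The closed form suits pieces that are images of
    compact intervals. *)
Lemma connected_closed_cover (T : topologicalType) (K A B : set T) :
  connected K -> closed A -> closed B -> K `<=` A `|` B ->
  K `&` A !=set0 -> K `&` B !=set0 -> K `&` A `&` B !=set0.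
Proof.
move=> cK cA cB KAB KA [y [Ky By]]; apply: contrapT => KAB0.
have KA' : K `&` A = K.
  apply: cK => //; [exists (~` B)|by exists A].
    exact: closed_openC.
  apply/seteqP; split=> x [Kx]; last by have [] := KAB x Kx.
  by move=> Ax; split=> // Bx; apply: KAB0; exists x.
apply: KAB0; exists y; split=> //; by rewrite KA'.
Qed.

Lemma subcontinuum_image (X : metricType R) (h : X -> R) (K : set X) :
  continuous h -> subcontinuum K ->
  exists a b, [/\ a <= b, (exists2 x, K x & h x = a),
    (exists2 x, K x & h x = b) & forall x, K x -> a <= h x <= b].
Proof.
move=> ch [K0 cK _].
have chK : {within K, continuous h} by exact: continuous_subspaceT.
have [u /set_mem Ku hu] := compact_EVT_min K0 cK chK.
have [v /set_mem Kv hv] := compact_EVT_max K0 cK chK.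
exists (h u), (h v); split; [by apply: hu; rewrite inE|by exists u|by exists v|].
by move=> x Kx; rewrite hu ?inE// hv ?inE.
Qed.

End metric_facts.

(** * The compactification of a ray *)

Section ray_space_def.
Context {R : realType} {X : metricType R}.
Variable phi : R -> X.

(** The height is the reciprocal of the ray parameter, so the base at height 0 stands for parameter
    infinity. *)
Definition on_ray_space (p : X * R) : Prop :=
  p.2 = 0 \/ (0 < p.2 <= 1 /\ p.1 = phi p.2^-1).

Definition ray_space := {p : X * R | `[< on_ray_space p >]}.

HB.instance Definition _ := Choice.on ray_space.

Definition ray_proj (p : ray_space) : X := (val p).1.
Definition height (p : ray_space) : R := (val p).2.

Lemma ray_space_inj (p q : ray_space) :
  ray_proj p = ray_proj q -> height p = height q -> p = q.
Proof.
by case: p => -[x s] i; case: q => -[y t] j; rewrite /ray_proj /height /= => xy st;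
  apply: val_inj; rewrite /= xy st.
Qed.

(** The sum metric makes [ray_proj] and [height] both 1-Lipschitz, and distance estimates split into
    a part in [X] and a part in heights. *)
Definition ray_dist (p q : ray_space) : R :=
  mdist (ray_proj p) (ray_proj q) + `|height p - height q|.

Lemma ray_distxx p : ray_dist p p = 0.
Proof. by rewrite /ray_dist mdistxx subrr normr0 addr0. Qed.

Lemma ray_dist_positivity p q : ray_dist p q = 0 -> p = q.
Proof.
rewrite /ray_dist => pq.
have := mdist_ge0 (ray_proj p) (ray_proj q); have := normr_ge0 (height p - height q).
move=> h1 h2; apply: ray_space_inj; first by apply: mdist_positivity; lra.
by apply/eqP; rewrite -subr_eq0 -normr_eq0; apply/eqP; lra.
Qed.

Lemma ray_dist_sym p q : ray_dist p q = ray_dist q p.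
Proof. by rewrite /ray_dist metric_sym distrC. Qed.

Lemma ray_dist_triangle q p r : ray_dist p r <= ray_dist p q + ray_dist q r.
Proof.
rewrite /ray_dist; have := metric_triangle (ray_proj p) (ray_proj q) (ray_proj r).
have := ler_distD (height q) (height p) (height r).
by move=> h1 h2; lra.
Qed.

HB.instance Definition _ := isMetric.Build R ray_space
  ray_distxx ray_dist_positivity ray_dist_sym ray_dist_triangle.

End ray_space_def.

Section ray_space_theory.
Context {R : realType} {X : metricType R}.
Variable phi : R -> X.
Notation Y := (ray_space phi).
Implicit Types p q z : Y.

Lemma ray_mdistE p q :
  mdist p q = mdist (ray_proj p) (ray_proj q) + `|height p - height q|.
Proof. by []. Qed.

Lemma ray_proj_mdist p q : mdist (ray_proj p) (ray_proj q) <= mdist p q.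
Proof. by rewrite ray_mdistE lerDl. Qed.

Lemma height_mdist p q : `|height p - height q| <= mdist p q.
Proof. by rewrite ray_mdistE lerDr mdist_ge0. Qed.

Lemma ray_proj_continuous : continuous (@ray_proj R X phi).
Proof. exact/lipschitz_continuous/ray_proj_mdist. Qed.

Lemma height_continuous : continuous (@height R X phi).
Proof.
exact/lipschitz_continuous_real/height_mdist.
Qed.

Lemma height_ge0 p : 0 <= height p.
Proof.
case: p => -[x s] i; have /asboolP := i; rewrite /height/= => -[/= ->//|].
by case=> /andP[/ltW].
Qed.

Lemma height_le1 p : height p <= 1.
Proof.
case: p => -[x s] i; have /asboolP := i; rewrite /height/= => -[/= ->//|].
by case=> /andP[].
Qed.

Lemma height_gt0P p : 0 < height p -> ray_proj p = phi (height p)^-1.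
Proof.
case: p => -[x s] i; have /asboolP := i; rewrite /height /ray_proj/= => -[/= ->//|].
  by rewrite ltxx.
by case.
Qed.

Lemma base_subproof x : `[< on_ray_space phi (x, 0) >].
Proof. by apply/asboolP; left. Qed.
Definition base x : Y := exist _ (x, 0) (base_subproof x).

Lemma height_base x : height (base x) = 0. Proof. by []. Qed.

Lemma baseK p : height p = 0 -> base (ray_proj p) = p.
Proof. by move=> p0; apply: ray_space_inj; rewrite ?height_base. Qed.

Lemma base_mdist x y : mdist (base x) (base y) = mdist x y.
Proof. by rewrite ray_mdistE /= !height_base subrr normr0 addr0. Qed.

Lemma base_continuous : continuous base.
Proof. by apply: lipschitz_continuous => x y; rewrite base_mdist. Qed.

Definition clamp01 (s : R) : R := if 0 < s <= 1 then s else 1.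

Lemma point_subproof s :
  `[< on_ray_space phi (phi (clamp01 s)^-1, clamp01 s) >].
Proof.
apply/asboolP; right; split=> //=; rewrite /clamp01.
by case: ifPn => //; rewrite ltr01 lexx.
Qed.

(* Outside ]0, 1] this is the junk value at height 1. *)
Definition ray_point s : Y := exist _ (_, _) (point_subproof s).

Lemma height_ray_point s : 0 < s <= 1 -> height (ray_point s) = s.
Proof. by rewrite /height /= /clamp01 => ->. Qed.

Lemma ray_proj_point s : 0 < s <= 1 -> ray_proj (ray_point s) = phi s^-1.
Proof. by rewrite /ray_proj /= /clamp01 => ->. Qed.

Lemma heightK p : 0 < height p -> ray_point (height p) = p.
Proof.
move=> p0; have p01 : 0 < height p <= 1 by rewrite p0 height_le1.
by apply: ray_space_inj; rewrite ?height_ray_point// ray_proj_point// height_gt0P.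
Qed.

Hypothesis cphi : continuous phi.

Lemma ray_point_continuous : {within `]0, 1]%classic, continuous ray_point}.
Proof.
apply/subspace_continuousP => s; rewrite /= in_itv /= => s01.
move=> U; rewrite -nbhs_ballE => -[e /= e0 eU].
rewrite nbhs_simpl /=.
have /andP[s0 _] := s01.
have cV : {for s, continuous (fun t : R => phi t^-1)}.
  apply: continuous_comp; last exact: cphi.
  by apply: inv_continuous; rewrite gt_eqF.
have e2 : 0 < e / 2 by lra.
have h1 : \forall t \near s, ball (phi s^-1) (e / 2) (phi t^-1).
  by apply: cV; exact: nbhsx_ballx.
have h2 : \forall t \near s, ball s (e / 2) t by exact: nbhsx_ballx.
apply: filterS2 h1 h2 => t /ball_mdist h1 h2 /=; rewrite in_itv /= => t01.
apply: eU; apply/ball_mdist.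
rewrite ray_mdistE !ray_proj_point// !height_ray_point//.
by move: h2; rewrite /ball/= => h2; lra.
Qed.

(** All points of height 0 belong to the set, so only limits at a height [s > 0] matter; there
    [t |-> phi t^-1] is continuous and its graph is closed. *)
Lemma ray_set_closed : closed [set p | on_ray_space phi p].
Proof.
move=> [x s] cxs.
have s01 : 0 <= s <= 1.
  have cC : closed [set p : X * R | 0 <= p.2 <= 1].
    rewrite (_ : mkset _ = snd @^-1` `[0, 1]%classic); last first.
      by apply/seteqP; split=> p /=; rewrite in_itv.
    by apply: preimage_closed => //; [move=> ? _; exact: cvg_snd|exact: interval_closed].
  apply: (cC (x, s)); apply: closureS cxs => p /= [->|[/andP[/ltW -> ->]]]//=.
  by rewrite lexx ler01.
have [->|s0] := eqVneq s 0; first by left.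
right; have {}s0 : 0 < s by rewrite lt_neqAle eq_sym s0; case/andP: s01.
split; first by rewrite s0; case/andP: s01.
rewrite /=; apply: contrapT => xphi.
have cV : {for s, continuous (fun t : R => phi t^-1)}.
  apply: continuous_comp; last exact: cphi.
  by apply: inv_continuous; rewrite gt_eqF.
pose e := mdist x (phi s^-1) / 2.
have e0 : 0 < e by rewrite divr_gt0// mdist_gt0; exact/eqP.
have : \forall p \near (x, s), mdist x p.1 < e /\
    (0 < p.2 /\ mdist (phi s^-1) (phi p.2^-1) < e).
  exists (ball x e, [set t | 0 < t /\ mdist (phi s^-1) (phi t^-1) < e]).
    split=> /=; first exact: nbhsx_ballx.
    apply: filterI; first exact: lt_nbhsr.
    by near=> t; apply/ball_mdist; near: t; apply: cV; exact: nbhsx_ballx.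
  by move=> [y t] /= [/ball_mdist].
move=> /cxs[[y t] /=] [[/= ->|[_ /= ->]] [h1 [h2 h3]]]; first by rewrite ltxx in h2.
have := metric_triangle x (phi t^-1) (phi s^-1).
by rewrite (metric_sym (phi t^-1) (phi s^-1)) /e in h1 h3 *; lra.
Unshelve. all: by end_near. Qed.

End ray_space_theory.

Section ray_space_continuum.
Context {R : realType} {X : metricType R}.
Variable phi : R -> X.
Notation Y := (ray_space phi).
Hypotheses (cX : compact [set: X]) (kX : connected [set: X]).
Hypothesis X0 : [set: X] !=set0.
Hypothesis cphi : continuous phi.
Hypothesis dphi : forall x (e T : R), 0 < e ->
  exists2 t, T <= t & mdist x (phi t) < e.
Implicit Types (p q z : Y) (K : set Y) (a b : R).

Lemma ray_space_compact : compact [set: Y].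
Proof.
(* [j] is made total by a junk value off the set. On the set it preserves the sum of the two
   distances, so compactness passes from a closed part of the product of [X] and [[0, 1]] to [Y]. *)
pose j (w : X * R) : Y :=
  if pselect (on_ray_space phi w) is left h then exist _ w (asboolT h)
  else base phi w.1.
have jE (p : X * R) : on_ray_space phi p -> val (j p) = p.
  by rewrite /j; case: pselect.
have jd (v w : X * R) : on_ray_space phi v -> on_ray_space phi w ->
    mdist (j v) (j w) = mdist v.1 w.1 + `|v.2 - w.2|.
  by move=> vS wS; rewrite ray_mdistE /ray_proj /height !jE.
have cS : compact [set w | on_ray_space phi w].
  apply: (@subclosed_compact _ _ ([set: X] `*` (`[0, 1]%classic : set R))).
  - exact: ray_set_closed.
  - by apply: compact_setX => //; exact: segment_compact.
  - move=> p [p0|[/andP[/ltW p0 p1] _]]; split=> //=; rewrite in_itv /= ?p0 ?p1//.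
    by rewrite lexx ler01.
have -> : [set: Y] = j @` [set w | on_ray_space phi w].
  apply/esym/seteqP; split=> // q _.
  have qS : on_ray_space phi (val q) by exact: (asboolW (valP q)).
  by exists (val q) => //; apply: val_inj; rewrite jE.
apply: continuous_compact => //.
apply/subspace_continuousP => -[x s] /= xsS.
move=> U; rewrite -nbhs_ballE => -[e /= e0 eU]; rewrite nbhs_simpl /=.
have e2 : 0 < e / 2 by lra.
exists (ball x (e / 2), ball s (e / 2)); first by split; exact: nbhsx_ballx.
move=> [y t] /= [/ball_mdist xy st] ytS; apply: eU; apply/ball_mdist.
have : mdist (j (x, s)) (j (y, t)) < e; last by [].
rewrite jd//=; have {}st : `|s - t| < e / 2 := st.
by have := ltrD xy st; rewrite -splitr.
Qed.


Definition slab a b : set Y := [set p | a <= height p <= b].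

Lemma slab_closed a b : closed (slab a b).
Proof.
rewrite (_ : slab a b = (@height _ _ phi) @^-1` `[a, b]%classic); last first.
  by apply/seteqP; split=> p /=; rewrite in_itv.
by apply: preimage_closed; [move=> ? _; exact: height_continuous|exact: interval_closed].
Qed.

Lemma slab0 : slab 0 0 = base phi @` [set: X].
Proof.
apply/seteqP; split=> [p /= p0|_ [x _ <-]]; last first.
  by rewrite /slab /= height_base lexx.
by exists (ray_proj p) => //; apply: baseK; apply/eqP; rewrite eq_le andbC.
Qed.

Lemma slab_image a b : 0 < a -> b <= 1 ->
  slab a b = ray_point phi @` `[a, b]%classic.
Proof.
move=> a0 b1; apply/seteqP; split=> [p /= pab|_ [s + <-]].
  exists (height p); first by rewrite /= in_itv.
  by apply: heightK; case/andP: pab; lra.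
by rewrite /= in_itv /= /slab/= => /andP[s1 s2]; rewrite height_ray_point; lra.
Qed.

Lemma ray_image b : b <= 1 ->
  [set p : Y | 0 < height p <= b] = ray_point phi @` `]0, b]%classic.
Proof.
move=> b1; apply/seteqP; split=> [p /= pab|_ [s + <-]].
  exists (height p); first by rewrite /= in_itv.
  by apply: heightK; case/andP: pab.
by rewrite /= in_itv /= => /andP[s1 s2]; rewrite height_ray_point; lra.
Qed.

Lemma ray_connected b : b <= 1 -> connected [set p : Y | 0 < height p <= b].
Proof.
move=> b1; rewrite ray_image//; apply: connected_continuous_connected.
  by apply/connected_intervalP; exact: interval_is_interval.
apply: continuous_subspaceW (ray_point_continuous cphi) => s /=.
by rewrite !in_itv/=; lra.
Qed.

Lemma closure_ray b : 0 < b -> slab 0 b `<=` closure [set p | 0 < height p <= b].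
Proof.
move=> b0 p /= /andP[p0 pb].
have [/eqP p00|p00] := boolP (height p == 0); last first.
  by apply: subset_closure; rewrite /= pb andbT lt_neqAle eq_sym p00.
move=> U; rewrite -nbhs_ballE => -[e /= e0 eU].
have e2 : 0 < e / 2 by lra.
(* Height at most [b] puts the chosen point in the ray part, at most [e / 2] makes its height
   negligible, and at most 1 keeps [ray_point] off its junk value. *)
pose d := Num.min (Num.min b (e / 2)) 1.
have [db de d1 d0] : [/\ d <= b, d <= e / 2, d <= 1 & 0 < d].
  by split; rewrite /d ?lt_min ?b0 ?e2 ?ltr01// !ge_min !lexx ?orbT.
have [t td xt] := dphi (ray_proj p) d^-1 e2.
have t0 : 0 < t by apply: lt_le_trans td; rewrite invr_gt0.
have td' : t^-1 <= d by rewrite -[d]invrK lef_pV2// posrE invr_gt0.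
have ti0 : 0 < t^-1 by rewrite invr_gt0.
have t01 : 0 < t^-1 <= 1 by lra.
exists (ray_point phi t^-1); split; first by rewrite /= height_ray_point//; lra.
apply: eU; apply/ball_mdist.
rewrite ray_mdistE ray_proj_point// height_ray_point// p00 invrK sub0r normrN.
by rewrite gtr0_norm//; lra.
Qed.

(** Above the base a slab is a path. From height 0 up to [b > 0] it is the closure of its ray part,
    by density of the tails; at height 0 alone it is a copy of [X]. *)
Lemma slab_connected a b : 0 <= a -> b <= 1 -> connected (slab a b).
Proof.
rewrite le_eqVlt => /orP[/eqP <-|a0] b1; last first.
  rewrite slab_image//; apply: connected_continuous_connected.
    by apply/connected_intervalP; exact: interval_is_interval.
  apply: continuous_subspaceW (ray_point_continuous cphi) => s /=.
  by rewrite !in_itv/=; lra.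
have [b0|b0|->] := ltgtP b 0.
- suff -> : slab 0 b = set0 by exact: connected0.
  apply/seteqP; split=> p //; rewrite /slab /= => /andP[h1 h2].
  by have := le_lt_trans (le_trans h1 h2) b0; rewrite ltxx.
- rewrite (_ : slab 0 b = closure [set p : Y | 0 < height p <= b]).
    exact/connected_closure/ray_connected.
  apply/seteqP; split; first exact: closure_ray.
  rewrite [X in _ `<=` X](closure_id _).1; last exact: slab_closed.
  by apply: closureS => p /= /andP[/ltW h1 h2]; rewrite /slab /= h1.
- rewrite slab0; apply: connected_continuous_connected => //.
  exact/continuous_subspaceT/base_continuous.
Qed.

Lemma slab_subcontinuum a b : 0 <= a -> a <= b -> b <= 1 ->
  subcontinuum (slab a b).
Proof.
move=> a0 ab b1; apply/(subcontinuumP _ ray_space_compact).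
split; [|exact: slab_closed|exact: slab_connected].
have [x _] := X0.
have [a00|a00] := eqVneq a 0; first by exists (base phi x); rewrite /slab/= height_base; lra.
have a0' : 0 < a by rewrite lt_neqAle eq_sym a00.
by exists (ray_point phi a); rewrite /slab/= height_ray_point; lra.
Qed.

Lemma slab01 : slab 0 1 = [set: Y].
Proof. by apply/seteqP; split=> // p _; rewrite /slab/= height_ge0 height_le1. Qed.

(** The heights of [K] form an interval and each positive height carries a single point of [Y], so
    [K] contains the whole ray between its extreme heights. If [K] also touches the base, closedness
    and density of the tails give it the entire base. *)
Lemma subcontinuum_slab K : subcontinuum K ->
  K `<=` slab 0 0 \/ exists a b, [/\ 0 <= a, a <= b, b <= 1 & K = slab a b].
Proof.
move=> sK; have [K0 cK kK] := (subcontinuumP _ ray_space_compact).1 sK.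
have [a [b [ab [u Ku ua] [v Kv vb] Kab]]] :=
  subcontinuum_image (@height_continuous _ _ phi) sK.
have a0 : 0 <= a by rewrite -ua height_ge0.
have b1 : b <= 1 by rewrite -vb height_le1.
have [b0|b0] := leP b 0.
  by left => p /Kab; rewrite /slab/= => /andP[h1 h2]; rewrite height_ge0 /=; lra.
right; exists a, b; split=> //; apply/seteqP; split=> // p /= /andP[ap pb].
have iK : is_interval ((@height _ _ phi) @` K).
  apply/connected_intervalP; apply: connected_continuous_connected => //.
  exact/continuous_subspaceT/height_continuous.
have hK s : a <= s <= b -> exists2 q, K q & height q = s.
  move=> sab; have /= := iK (height u) (height v).
  move=> /(_ _ _ s) h; have := h (ex_intro2 _ _ u Ku erefl)
    (ex_intro2 _ _ v Kv erefl).
  by rewrite ua vb => /(_ sab).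
have K_ray q : a <= height q <= b -> 0 < height q -> K q.
  move=> /hK[q' Kq' q'q] q0.
  by rewrite -(heightK q0) -q'q (heightK _)// q'q.
have [p0|p0] := ltP 0 (height p); first by apply: K_ray => //; rewrite ap.
rewrite ((closure_id K).1 cK).
have : closure [set q : Y | 0 < height q <= b] p.
  by apply: closure_ray => //; rewrite /slab/= height_ge0.
apply: closureS => q /= /andP[q0 qb]; apply: K_ray => //.
by rewrite qb andbT; lra.
Qed.

(** The points outside the neighbourhood form a compact set, so their heights form a closed set
    missing [[a, b]]. Only the gaps at [a] and [b] are used, since heights in between belong to the
    slab itself. *)
Lemma slab_nbhd a b (e : R) : a <= b -> 0 < e -> exists2 d, 0 < d & forall z,
  a - d < height z < b + d -> set_nbhd e (slab a b) z.
Proof.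
move=> ab e0; pose C := [set z | ~ set_nbhd e (slab a b) z].
have cC : closed C.
  by rewrite -openC setCK; exact: set_nbhd_open.
have kC : compact C by exact: subclosed_compact ray_space_compact _.
have cH : closed ((@height _ _ phi) @` C).
  apply: compact_closed; first exact: Rhausdorff.
  apply: continuous_compact => //.
  exact/continuous_subspaceT/height_continuous.
have far s : a <= s <= b -> exists2 d, 0 < d & forall z,
    `|height z - s| < d -> set_nbhd e (slab a b) z.
  move=> sab; have : nbhs s (~` ((@height _ _ phi) @` C)).
    apply: open_nbhs_nbhs; split; first exact: closed_openC.
    move=> -[z Cz zs]; apply: Cz; exists z; last exact: ballxx.
    by rewrite /slab/= zs.
  rewrite -nbhs_ballE => -[d /= d0 dC]; exists d => // z zd.
  apply: contrapT => nz; apply: (dC (height z)); last by exists z.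
  by rewrite /ball /= distrC.
have [d1 d10 h1] := far a (introT andP (conj (lexx a) ab)).
have [d2 d20 h2] := far b (introT andP (conj ab (lexx b))).
exists (Num.min d1 d2); first by rewrite lt_min d10.
move=> z /andP[za zb].
have [m1 m2] : Num.min d1 d2 <= d1 /\ Num.min d1 d2 <= d2.
  by rewrite !ge_min !lexx orbT.
have [ha|ha] := ltP (height z) a; first by apply: h1; rewrite ltr_norml; lra.
have [hb|hb] := ltP b (height z); first by apply: h2; rewrite ltr_norml; lra.
by apply: sub_set_nbhd => //; rewrite /slab/= ha.
Qed.

End ray_space_continuum.

Arguments slab {R X} phi a b.

Lemma subcontinuum_continuous_image (R : realType) (X Z : metricType R)
    (f : X -> Z) (K : set X) :
  continuous f -> subcontinuum K -> subcontinuum (f @` K).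
Proof.
move=> cf [K0 cK kK]; split; first exact: image_nonempty.
  by apply: continuous_compact => //; exact: continuous_subspaceT.
by apply: connected_continuous_connected => //; exact: continuous_subspaceT.
Qed.

Lemma not_near_infty_ex (P E : nat -> Prop) :
  ~ (\forall n \near \oo, P n) -> (\forall n \near \oo, E n) ->
  exists2 n, E n & ~ P n.
Proof.
move=> nP nE; apply: contrapT => h; apply: nP; apply: filterS nE => n En.
by apply: contrapT => nPn; apply: h; exists n.
Qed.

(** * Maximal limit continua in the ray space *)

Section ray_space_semi_Kelley.
Context {R : realType} {X : metricType R}.
Variable phi : R -> X.
Notation Y := (ray_space phi).
Hypotheses (cX : compact [set: X]) (kX : connected [set: X]).
Hypothesis X0 : [set: X] !=set0.
Hypothesis cphi : continuous phi.
Hypothesis dphi : forall x (e T : R), 0 < e ->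
  exists2 t, T <= t & mdist x (phi t) < e.
Hypothesis lphi : forall a b (A : set X), a <= b -> subcontinuum A ->
  A <> [set: X] -> (forall t, a <= t <= b -> A (phi t)) ->
  exists c d, [/\ c <= a, b <= d, forall t, c <= t <= d -> A (phi t) &
    A `<=` phi @` `[c, d]%classic].
Implicit Types (K L M : set Y).

Let cY := ray_space_compact cX cphi.

Lemma slab_maximal_limit_continuum (a b : R) M : 0 <= a -> a <= b -> b <= 1 ->
  maximal_limit_continuum (slab phi a b) M -> M = slab phi a b.
Proof.
move=> a0 ab b1 [sM MK [M_ [sM_ cM_ maxM]]].
have /choice[h hM] : forall n, exists h : R * R, [/\ 0 <= h.1, h.2 <= 1,
    (exists2 u, M_ n u & height u = h.1),
    (exists2 u, M_ n u & height u = h.2) &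
    forall u, M_ n u -> h.1 <= height u <= h.2].
  move=> n; have [u [v [uv [p Mp pu] [q Mq qv] H]]] :=
    subcontinuum_image (@height_continuous _ _ phi) (sM_ n).
  exists (u, v); split=> //=; [by rewrite -pu height_ge0|by rewrite -qv height_le1| |].
  - by exists p.
  - by exists q.
(* The height range of [M_ n] is enlarged to contain [[a, b]]. Since [M_ n] approaches [M], whose
   heights lie in [[a, b]], the enlarged slabs converge to the slab over [[a, b]]. *)
pose M' n : set Y := slab phi (Num.min a (h n).1) (Num.max b (h n).2).
have sub n : slab phi a b `<=` M' n.
  by move=> p /andP[h1 h2]; rewrite /M' /slab/= ge_min le_max h1 h2.
have sM' n : subcontinuum (M' n).
  have [h0 h1 _ _ _] := hM n.
  apply: slab_subcontinuum => //; rewrite ?le_min ?ge_max ?a0 ?b1//.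
  by rewrite ge_min le_max ab.
symmetry; apply: (maxM M') => //.
- exact: slab_subcontinuum.
- apply/(subcontinuum_cvgP cY) => // [|e e0]; first exact: slab_subcontinuum.
  have [d d0 hd] := slab_nbhd cX cphi ab e0.
  have MM := (subcontinuum_cvgP cY sM_ sM).1 cM_.
  apply: filterS (MM d d0) => n [Mn _]; split; last first.
    by move=> p Kp; apply: sub_set_nbhd => //; exact: sub.
  have [_ _ [u Mu hu] [v Mv hv] _] := hM n.
  have [p Mp /ball_mdist pu] := Mn u Mu; have [q Mq /ball_mdist qv] := Mn v Mv.
  have /andP[pa pb] := MK p Mp; have /andP[qa qb] := MK q Mq.
  have := le_lt_trans (height_mdist p u) pu.
  have := le_lt_trans (height_mdist q v) qv.
  rewrite hu hv !ltr_norml => /andP[q1 q2] /andP[p1 p2].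
  move=> z; rewrite /M' /slab /= => /andP[z1 z2]; apply: hd.
  apply/andP; split.
    by apply: lt_le_trans z1; rewrite lt_min; apply/andP; split; lra.
  by apply: (le_lt_trans z2); rewrite gt_max; apply/andP; split; lra.
- move=> n p Mp; have [_ _ _ _ /(_ p Mp)/andP[h1 h2]] := hM n.
  by rewrite /M' /slab /= ge_min le_max h1 h2 !orbT.
Qed.

(** If [M] lies on the base, a copy of [N] on the base serves. Otherwise [M] is a slab at positive
    heights, as a slab touching the base projects onto [X], and [lphi] extends its parameter
    interval until it covers [N]. The extension may run past the start of the ray, whence the
    alternative of height 1, which also absorbs the case [N = X]. *)
Lemma proj_lift (M : set Y) (N : set X) : subcontinuum M -> subcontinuum N ->
  @ray_proj R X phi @` M `<=` N ->
  exists M', [/\ subcontinuum M', M `<=` M', @ray_proj R X phi @` M' `<=` N &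
    N `<=` @ray_proj R X phi @` M' \/ exists2 z, M' z & height z = 1].
Proof.
move=> sM sN MN.
have r1 : height (ray_point phi 1) = 1 by rewrite height_ray_point// ltr01 lexx.
have [NT|NT] := pselect (N = [set: X]).
  exists [set: Y]; split=> //; last by right; exists (ray_point phi 1).
  - by rewrite -slab01; apply: slab_subcontinuum => //; exact: ler01.
  - by rewrite NT.
have [M0|[a [b [a0 ab b1 ME]]]] := subcontinuum_slab cX cphi dphi sM.
  have rb : @ray_proj R X phi @` (base phi @` N) = N.
    apply/seteqP; split=> [_ [_ [x Nx <-] <-]//|x Nx].
    by exists (base phi x) => //; exists x.
  exists (base phi @` N); rewrite rb; split=> //; last by left.
    by apply: subcontinuum_continuous_image => //; exact: base_continuous.
  move=> p Mp; exists (ray_proj p); first by apply: MN; exists p.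
  apply: baseK; apply/eqP; rewrite eq_le height_ge0 andbT.
  by have /andP[_] := M0 p Mp.
have {}a0 : 0 < a.
  rewrite lt_neqAle a0 andbT; apply/eqP => a00; apply: NT; apply/seteqP; split=> // x _.
  apply: MN; exists (base phi x) => //; rewrite ME /slab /= height_base -a00 lexx.
  by rewrite a00.
have b0 : 0 < b by exact: lt_le_trans ab.
have iab : b^-1 <= a^-1 by rewrite lef_pV2.
have [|c [d [cb da cdN Ncd]]] := lphi iab sN NT.
  move=> t /andP[bt ta]; have t0 : 0 < t by apply: lt_le_trans bt; rewrite invr_gt0.
  have ta' : a <= t^-1 by rewrite -[a]invrK lef_pV2// posrE invr_gt0.
  have bt' : t^-1 <= b by rewrite -[b]invrK lef_pV2// posrE invr_gt0.
  have t1 : 0 < t^-1 <= 1 by rewrite invr_gt0 t0 (le_trans bt').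
  apply: MN; exists (ray_point phi t^-1); last by rewrite ray_proj_point// invrK.
  by rewrite ME /slab /= height_ray_point// ta'.
(* Parameters below 1 do not occur in [Y], so the lifted interval is cut off at 1; when [c < 1] the
   resulting slab contains the top of the ray. *)
pose c' := Num.max c 1.
have [cc' c'1] : c <= c' /\ 1 <= c' by rewrite !le_max !lexx orbT.
have b1' : 1 <= b^-1 by rewrite -invr1 lef_pV2// posrE.
have c'b : c' <= b^-1 by rewrite ge_max cb.
have c'd : c' <= d by rewrite (le_trans c'b)// (le_trans iab).
have d0 : 0 < d by lra.
have c'0 : 0 < c' by lra.
exists (slab phi d^-1 c'^-1); split.
- apply: slab_subcontinuum => //.
  + by rewrite invr_ge0 ltW.
  + by rewrite lef_pV2.
  + by rewrite -invr1 lef_pV2// posrE.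
- move=> p; rewrite ME /slab /= => /andP[ap pb].
  rewrite (le_trans _ ap) ?(le_trans pb)//.
    by rewrite -[b]invrK lef_pV2// posrE invr_gt0.
  by rewrite -[a]invrK lef_pV2// posrE invr_gt0.
- move=> _ [p /andP[dp pc] <-].
  have p0 : 0 < height p by apply: lt_le_trans dp; rewrite invr_gt0.
  rewrite height_gt0P//; apply: cdN; apply/andP; split.
    by rewrite (le_trans cc')// -[c']invrK lef_pV2// posrE invr_gt0.
  by rewrite -[d]invrK lef_pV2// posrE invr_gt0.
- have [c1|c1] := leP 1 c; [left|right]; last first.
    exists (ray_point phi 1) => //; rewrite /slab/= r1.
    have -> : c' = 1 by rewrite /c' max_r// ltW.
    rewrite invr1 lexx andbT -invr1 lef_pV2// ?posrE//.
    by rewrite (le_trans b1')// (le_trans iab).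
  have c'E : c' = c by rewrite /c' max_l.
  move=> x /Ncd[t]; rewrite /= in_itv /= => /andP[ct td] <-.
  have t0 : 0 < t by lra.
  have t1 : 0 < t^-1 <= 1 by rewrite invr_gt0 t0 -invr1 lef_pV2// ?posrE//; lra.
  exists (ray_point phi t^-1); last by rewrite ray_proj_point// invrK.
  by rewrite /slab /= height_ray_point// c'E !lef_pV2// ?posrE ?td//; lra.
Qed.

Section level0.
Variables K L : set Y.
Hypotheses (sK : subcontinuum K) (K0 : K `<=` slab phi 0 0).
Hypothesis KT : K <> slab phi 0 0.
Notation rp := (@ray_proj R X phi).

Let K_base p : K p -> base phi (rp p) = p.
Proof.
move=> Kp; apply: baseK; apply/eqP; rewrite eq_le height_ge0 andbT.
by have /andP[_] := K0 Kp.
Qed.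

Let KN : rp @` K <> [set: X].
Proof.
move=> KE; apply: KT; apply/seteqP; split=> // p.
rewrite slab0 => -[x _ <-]; have [q Kq <-] : (rp @` K) x by rewrite KE.
by rewrite K_base.
Qed.

Let srp (M : set Y) : subcontinuum M -> subcontinuum (rp @` M).
Proof. exact/subcontinuum_continuous_image/ray_proj_continuous. Qed.

(** A test sequence [N_ n] for the projections is lifted to continua [M' n] containing [M_ n]. Once
    the heights of [M' n] tend to 0, these converge to the copy of [N] on the base, and maximality
    of [L] identifies that copy with [L]. *)
Lemma proj_maximal_limit_continuum : maximal_limit_continuum K L ->
  maximal_limit_continuum (rp @` K) (rp @` L).
Proof.
move=> [sL LK [M_ [sM_ cM_ maxM]]].
have cM := (subcontinuum_cvgP cY sM_ sL).1 cM_.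
have L0 p : L p -> height p = 0.
  by move=> /LK/K0/= /andP[h1 h2]; apply/eqP; rewrite eq_le h1 h2.
split; [exact: srp|exact: image_subset|].
exists (fun n => rp @` M_ n); split; first by move=> n; exact: srp.
  apply/(subcontinuum_cvgP cX) => [n||e e0]; [exact: srp|exact: srp|].
  apply: filterS (cM e e0) => n [h1 h2]; split=> _ [p Mp <-].
    have [q Lq /ball_mdist pq] := h1 p Mp; exists (rp q); first by exists q.
    by apply/ball_mdist; apply: le_lt_trans pq; exact: ray_proj_mdist.
  have [q Lq /ball_mdist pq] := h2 p Mp; exists (rp q); first by exists q.
  by apply/ball_mdist; apply: le_lt_trans pq; exact: ray_proj_mdist.
move=> N_ N sN_ sN cN_ MN NK.
have cN := (subcontinuum_cvgP cX sN_ sN).1 cN_.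
have /choice[M' HM'] := fun n => proj_lift (sM_ n) (sN_ n) (MN n).
have sM' n : subcontinuum (M' n) by have [] := HM' n.
(* Otherwise, for arbitrarily late [n], [M' n] contains points near the base, coming from [M_ n],
   and a point of height at least [e], hence the ray points in between. Then [phi t] lies in the
   closed set [N] for all large [t], and density of the tails makes the projection of [K] equal to
   [X]. *)
have low (e : R) : 0 < e -> \forall n \near \oo, forall p, M' n p -> height p < e.
  move=> e0; apply: contrapT => nlow; apply: KN; apply/seteqP; split=> // x _.
  have cK : closed (rp @` K) by apply: compact_metric_closed; case: (srp sK).
  have cNc : closed N by apply: compact_metric_closed; case: sN.
  rewrite ((closure_id _).1 cK) => U; rewrite -nbhs_ballE => -[r /= r0 rU].
  have [t et xt] := dphi x e^-1 r0.
  exists (phi t); split; last exact/rU/ball_mdist.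
  apply: NK; rewrite ((closure_id _).1 cNc) => V; rewrite -nbhs_ballE => -[d /= d0 dV].
  have t0 : 0 < t by apply: lt_le_trans et; rewrite invr_gt0.
  have it0 : 0 < t^-1 by rewrite invr_gt0.
  have te : t^-1 <= e by rewrite -[e]invrK lef_pV2// posrE invr_gt0.
  have [n [[MnL _] [NnN _]]] := not_near_infty_ex nlow (filterI (cM _ it0) (cN _ d0)).
  move=> /existsNP[z /not_implyP[M'z /negP]]; rewrite -leNgt => ez.
  have [[u Mu] _ _] := sM_ n; have [_ MM' M'N _] := HM' n.
  have ut : height u < t^-1.
    have [v Lv /ball_mdist vu] := MnL u Mu.
    have := le_lt_trans (height_mdist v u) vu; rewrite (L0 v Lv) sub0r normrN.
    by apply: le_lt_trans; exact: ler_norm.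
  have iK : is_interval ((@height _ _ phi) @` (M' n)).
    apply/connected_intervalP; apply: connected_continuous_connected.
      by case: (sM' n).
    exact/continuous_subspaceT/height_continuous.
  have [w M'w wt] : ((@height _ _ phi) @` (M' n)) t^-1.
    apply: (iK (height u) (height z)); [by exists u => //; exact: MM'|by exists z|].
    by rewrite (ltW ut) (le_trans te).
  have : N_ n (phi t).
    apply: M'N; exists w => //; rewrite height_gt0P ?wt//.
    by rewrite invrK.
  move=> /NnN[m Nm /ball_mdist mt]; exists m; split=> //; apply/dV/ball_mdist.
  by rewrite metric_sym.
have sbN : subcontinuum (base phi @` N).
  by apply: subcontinuum_continuous_image => //; exact: base_continuous.
have bNK : base phi @` N `<=` K.
  by move=> _ [x /NK[p Kp <-] <-]; rewrite K_base.
suff <- : base phi @` N = L.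
  apply/seteqP; split=> [x Nx|_ [_ [x Nx <-] <-]//].
  by exists (base phi x) => //; exists x.
apply: (maxM M') => //; last by move=> n; have [] := HM' n.
apply/(subcontinuum_cvgP cY) => // e e0.
have e2 : 0 < e / 2 by lra.
(* Heights below 1 exclude the second alternative of [proj_lift]; heights below [e / 2] leave the
   other half of [e] for the distance in [X]. *)
have m0 : 0 < Num.min 1 (e / 2) by rewrite lt_min ltr01.
apply: filterS2 (low _ m0) (cN _ e2) => n lown [NnN NNn].
have [_ MM' M'N M'top] := HM' n.
have d_base x p : mdist (base phi x) p = mdist x (rp p) + height p.
  by rewrite ray_mdistE height_base sub0r normrN ger0_norm// height_ge0.
split.
  move=> z M'z; have /M'N/NnN[m Nm /ball_mdist mz] : (rp @` M' n) (rp z) by exists z.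
  exists (base phi m); first by exists m.
  apply/ball_mdist; rewrite d_base.
  have := lown z M'z; rewrite lt_min => /andP[_ ze].
  by rewrite [ltRHS]splitr ltrD.
move=> _ [m Nm <-]; have [x Nnx /ball_mdist xm] := NNn m Nm.
have {M'top}[M'top|[z /lown + z1]] := M'top; last by rewrite z1 lt_min ltxx.
have [z M'z zx] := M'top x Nnx; exists z => //; apply/ball_mdist.
rewrite metric_sym d_base zx metric_sym.
have := lown z M'z; rewrite lt_min => /andP[_ ze].
by rewrite [ltRHS]splitr ltrD.
Qed.

End level0.

Lemma ray_space_semi_Kelley : semi_Kelley X -> semi_Kelley Y.
Proof.
move=> [[_ _ [x [y xy]]] skX].
have sY : subcontinuum [set: Y].
  by rewrite -slab01; apply: slab_subcontinuum => //; exact: ler01.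
split.
  split=> //; first by case: sY.
  by exists (base phi x), (base phi y) => /(congr1 (@ray_proj R X phi)).
move=> K sK L M mL mM.
have slabK a b : 0 <= a -> a <= b -> b <= 1 -> K = slab phi a b -> L `<=` M.
  move=> a0 ab b1 KE; rewrite KE in mL mM.
  by rewrite (slab_maximal_limit_continuum a0 ab b1 mL)
    (slab_maximal_limit_continuum a0 ab b1 mM).
have [K0|[a [b [a0 ab b1 KE]]]] := subcontinuum_slab cX cphi dphi sK; last first.
  by left; exact: slabK KE.
have [KT|KT] := pselect (K = slab phi 0 0).
  by left; apply: slabK KT => //; exact: ler01.
have sub L1 M1 : L1 `<=` K -> M1 `<=` K ->
    @ray_proj R X phi @` L1 `<=` @ray_proj R X phi @` M1 -> L1 `<=` M1.
  move=> LK MK LM p Lp.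
  have [q Mq qp] : (@ray_proj R X phi @` M1) (ray_proj p) by apply: LM; exists p.
  have K00 r : K r -> height r = 0.
    by move=> /K0/andP[h1 h2]; apply/eqP; rewrite eq_le h1 h2.
  by rewrite (_ : p = q)//; apply: ray_space_inj => //; rewrite !K00//; [exact: MK|exact: LK].
have [] := skX _ (subcontinuum_continuous_image (@ray_proj_continuous _ _ phi) sK)
  _ _ (proj_maximal_limit_continuum sK K0 KT mL)
  (proj_maximal_limit_continuum sK K0 KT mM).
  by left; apply: sub => //; [case: mL|case: mM].
by right; apply: sub => //; [case: mM|case: mL].
Qed.

End ray_space_semi_Kelley.

Lemma set_type_continuous (S T : topologicalType) (A : set T)
    (f : S -> set_type A) :
  continuous (fun x => val (f x)) -> continuous f.
Proof.
move=> cf z U [?/= [[W oW <-]]] /= Wsfz /filterS; apply; apply: cf.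
exact: open_nbhs_nbhs.
Qed.

(** * The ray space as a compactification with remainder [X] *)

Section ray_space_compactification.
Context {R : realType} {X : metricType R}.
Variable phi : R -> X.
Notation Y := (ray_space phi).
Hypotheses (cX : compact [set: X]) (kX : connected [set: X]).
Hypothesis X2 : exists x y : X, x <> y.
Hypothesis cphi : continuous phi.
Hypothesis dphi : forall x (e T : R), 0 < e ->
  exists2 t, T <= t & mdist x (phi t) < e.

Lemma base_homeomorphic : homeomorphic X (set_type (slab phi 0 0)).
Proof.
have sb x : base phi x \in slab phi 0 0.
  by rewrite inE /slab/= height_base lexx.
exists (fun x => exist _ (base phi x) (sb x)).
exists (fun p => ray_proj (val p)); split.
- by move=> x.
- move=> -[p p0]; apply: val_inj => /=; apply: baseK.
  by move: p0; rewrite inE => /andP[h1 h2]; apply/eqP; rewrite eq_le h1 h2.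
- by apply: set_type_continuous; exact: base_continuous.
- move=> p; apply: continuous_comp; last exact: ray_proj_continuous.
  exact: initial_continuous.
Qed.

Lemma ray_homeomorphic :
  homeomorphic (set_type [set p : Y | 0 < height p])
    (set_type (`]0, 1]%classic : set R)).
Proof.
have hP (p : set_type [set p : Y | 0 < height p]) :
    height (val p) \in (`]0, 1]%classic : set R).
  by rewrite inE /= in_itv /= height_le1 andbT; case: p => p /=; rewrite inE.
have s01 (s : set_type (`]0, 1]%classic : set R)) : 0 < val s <= 1.
  by case: s => s /=; rewrite inE /= in_itv.
have rP (s : set_type (`]0, 1]%classic : set R)) :
    ray_point phi (val s) \in [set p : Y | 0 < height p].
  by have /andP[s0 _] := s01 s; rewrite inE; rewrite -(height_ray_point phi (s01 s)) in s0.
exists (fun p => exist _ (height (val p)) (hP p)).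
exists (fun s => exist _ (ray_point phi (val s)) (rP s)); split.
- by move=> [p p0]; apply: val_inj => /=; apply: heightK; rewrite inE in p0.
- by move=> s; apply: val_inj; exact: (height_ray_point phi (s01 s)).
- apply: set_type_continuous => p; apply: continuous_comp.
    exact: initial_continuous.
  exact: height_continuous.
- apply: set_type_continuous => /=.
  exact/subspace_sigL_continuousP/ray_point_continuous.
Qed.

Lemma ray_space_compactification :
  compactification_with_remainder (slab phi 0 0).
Proof.
have [x [y xy]] := X2.
have X0 : [set: X] !=set0 by exists x.
have [_ cY kY] : subcontinuum [set: Y].
  by rewrite -slab01; apply: slab_subcontinuum => //; exact: ler01.
split.
  by split=> //; exists (base phi x), (base phi y) => /(congr1 (@ray_proj R X phi))/xy.
exists [set p | 0 < height p]; split.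
- exact: ray_homeomorphic.
- move=> U [p Up] oU.
  have [|q [/= /andP[q0 _] Uq]] := closure_ray dphi ltr01 (_ : slab phi 0 1 p) (open_nbhs_nbhs (conj oU Up)).
    by rewrite slab01.
  by exists q.
- apply/seteqP; split=> // p [/= p0]; rewrite /slab/= => /andP[_].
  by rewrite leNgt p0.
- apply/seteqP; split=> // p _; have := height_ge0 p.
  by rewrite le_eqVlt => /orP[/eqP p0|]; [right; rewrite /slab/= -p0 lexx|left].
Qed.

End ray_space_compactification.

(* phi is defined on all of R, so that lifts never hit an end point of the ray;
   only the part with parameter at least 1 enters ray_space. *)
Definition lifting_ray (R : realType) (X : metricType R) (phi : R -> X) :=
  [/\ continuous phi,
    forall x (e T : R), 0 < e -> exists2 t, T <= t & mdist x (phi t) < e &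
    forall a b (A : set X), a <= b -> subcontinuum A -> A <> [set: X] ->
      (forall t, a <= t <= b -> A (phi t)) ->
      exists c d, [/\ c <= a, b <= d, forall t, c <= t <= d -> A (phi t) &
        A `<=` phi @` `[c, d]%classic]].

Lemma lifting_ray_semi_Kelley_remainder (R : realType) (X : metricType R)
    (phi : R -> X) :
  semi_Kelley X -> lifting_ray phi -> semi_Kelley_remainder X.
Proof.
move=> skX [cphi dphi lphi]; have [[cX kX X2] _] := skX.
have X0 : [set: X] !=set0 by have [x] := X2; exists x.
exists (ray_space phi), (slab phi 0 0); split.
- exact: ray_space_compactification.
- exact: ray_space_semi_Kelley.
- exact: base_homeomorphic.
Qed.

(** * Paths with convex fibers *)

Section paths.
Context {R : realType} {X : metricType R}.
Implicit Types (f : R -> X) (A K : set X).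

(** A weak monotonicity: a value may be kept for a while but not taken up again later. Restricting
    to values in [A] serves loops, where the two ends of a period share a value outside [A]. *)
Definition convex_fibers_over A f (l r : R) := forall s t u : R,
  l <= s -> s <= t -> t <= u -> u <= r -> f s = f u -> A (f s) -> f t = f s.

Definition injective_on f (l r : R) := forall s t : R,
  l <= s <= r -> l <= t <= r -> f s = f t -> s = t.

Lemma path_image_compact f l r : continuous f -> compact (f @` `[l, r]%classic).
Proof.
move=> cf; apply: continuous_compact; last exact: segment_compact.
exact: continuous_subspaceT.
Qed.

Lemma path_image_connected f l r : continuous f ->
  connected (f @` `[l, r]%classic).
Proof.
move=> cf; apply: connected_continuous_connected.
  by apply/connected_intervalP; exact: interval_is_interval.
exact: continuous_subspaceT.
Qed.

Lemma path_image_subcontinuum f l r : continuous f -> l <= r ->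
  subcontinuum (f @` `[l, r]%classic).
Proof.
move=> cf lr; split; [|exact: path_image_compact|exact: path_image_connected].
by exists (f l); exists l => //=; rewrite in_itv /= lexx.
Qed.

Lemma path_image_closed f l r : continuous f -> closed (f @` `[l, r]%classic).
Proof. by move=> cf; apply: compact_metric_closed; exact: path_image_compact. Qed.

(* The images of [l, t] and [t, r] cover A and are closed; by connectedness
   they share a point of A, and its fiber contains t. *)
Lemma convex_preimage A f l r s t u : continuous f -> connected A ->
  A `<=` f @` `[l, r]%classic -> convex_fibers_over A f l r ->
  l <= s -> s <= t -> t <= u -> u <= r -> A (f s) -> A (f u) -> A (f t).
Proof.
move=> cf kA Af Cf ls st tu ur As Au.
have [|||x [[Ax [s' s't s'x]] [u' u't us]]] := connected_closed_cover kA
  (path_image_closed (l := l) (r := t) cf) (path_image_closed (l := t) (r := r) cf).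
- move=> x /Af[v]; rewrite /= in_itv /= => /andP[lv vr] <-.
  by have [vt|tv] := leP v t; [left|right]; exists v; rewrite //= in_itv /= ?lv ?vr ?vt//= ltW.
- by exists (f s); split=> //; exists s; rewrite //= in_itv /= ls.
- by exists (f u); split=> //; exists u; rewrite //= in_itv /= tu.
move: s't u't Ax; rewrite /= !in_itv /= => /andP[ls' s't] /andP[tu' u'r] Ax.
rewrite -s'x in Ax us.
by rewrite (Cf s' t u' ls' s't tu' u'r (esym us) Ax).
Qed.

(** [c] and [d] are the least and the greatest parameter of the window [[l, r]] mapped into [A]; the
    assumed convexity of the preimage fills the interval between them. *)
Lemma lift_continuum A f l r a b : continuous f -> subcontinuum A ->
  A `<=` f @` `[l, r]%classic ->
  (forall s t u, l <= s -> s <= t -> t <= u -> u <= r ->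
    A (f s) -> A (f u) -> A (f t)) ->
  l <= a -> a <= b -> b <= r -> (forall t, a <= t <= b -> A (f t)) ->
  exists c d, [/\ l <= c <= a, b <= d <= r, forall t, c <= t <= d -> A (f t) &
    A `<=` f @` `[c, d]%classic].
Proof.
move=> cf [_ cA _] Af cvA la ab br Aab.
pose J := `[l, r]%classic `&` f @^-1` A.
have cJ : compact J.
  apply: compact_closedI; first exact: segment_compact.
  by apply: preimage_closed => //; exact: compact_metric_closed.
have J0 : J !=set0.
  by exists a; split; [rewrite /= in_itv /= la (le_trans ab)|apply: Aab; rewrite lexx].
have cid : {within J, continuous (fun t : R => t)}.
  by apply: continuous_subspaceT => t; exact: cvg_id.
have [c /set_mem[+ Ac] cmin] := compact_EVT_min J0 cJ cid.
have [d /set_mem[+ Ad] dmax] := compact_EVT_max J0 cJ cid.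
rewrite /= !in_itv /= => /andP[ld dr] /andP[lc cr].
have Jcd t : l <= t <= r -> A (f t) -> c <= t <= d.
  move=> ltr At; have tJ : t \in J by rewrite inE; split; rewrite //= in_itv.
  by rewrite (cmin t)// (dmax t).
have /andP[ca _] : c <= a <= d by apply: Jcd; [lra|apply: Aab; lra].
have /andP[_ bd] : c <= b <= d by apply: Jcd; [lra|apply: Aab; lra].
exists c, d; split=> // [||t /andP[ct td]|x Ax]; [by rewrite lc|by rewrite bd| |].
  exact: (cvA c t d).
have [t] := Af x Ax; rewrite /= in_itv /= => tlr tx; exists t => //=.
by rewrite in_itv /= Jcd// tx.
Qed.

(** The retraction of the line onto [[0, 1]]; composing with it makes a parametrization of an arc a
    path on all of [R]. *)
Definition clip (t : R) : R := Num.max 0 (Num.min 1 t).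

Lemma clip_itv t : 0 <= clip t <= 1.
Proof. by rewrite /clip le_max lexx ge_max ler01 ge_min lexx. Qed.

Lemma clip_id t : 0 <= t <= 1 -> clip t = t.
Proof. by rewrite /clip => /andP[t0 t1]; rewrite min_r// max_r. Qed.

Lemma clip_continuous : continuous clip.
Proof.
move=> t; apply: continuous_max; first exact: cst_continuous.
by apply: continuous_min; first exact: cst_continuous.
Qed.

Lemma arc_path A : is_arc R (set_type A) ->
  exists f, [/\ continuous f, f @` `[0, 1]%classic = A & injective_on f 0 1].
Proof.
move=> [F [G [FK GK cF cG]]].
have clipP t : clip t \in (`[0, 1]%classic : set R).
  by rewrite inE /= in_itv /= clip_itv.
pose cl t : set_type (`[0, 1]%classic : set R) := exist _ (clip t) (clipP t).
have ccl : continuous cl by apply: set_type_continuous; exact: clip_continuous.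
exists (fun t => val (G (cl t))); split.
- move=> t; apply: continuous_comp; first by apply: continuous_comp; [exact: ccl|exact: cG].
  exact: initial_continuous.
- apply/seteqP; split=> [_ [t _ <-]|x Ax]; first by case: (G _) => y /=; rewrite inE.
  have xA : x \in A by rewrite inE.
  pose s := F (exist _ x xA); exists (val s).
    by case: (s) => s' /=; rewrite inE.
  have -> : cl (val s) = s.
    apply: val_inj => /=; apply: clip_id.
    by case: (s) => s' /=; rewrite inE /= in_itv.
  by rewrite /s FK.
- move=> s t s01 t01 /val_inj/(can_inj GK)/(congr1 val) /=.
  by rewrite !clip_id.
Qed.

(** Points and arcs are treated alike: a one-point subcontinuum gets a constant path, whose fibers
    are convex although it is not injective. *)
Lemma proper_subcontinuum_path K : arc_continuum X -> subcontinuum K ->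
  K <> [set: X] -> exists f, [/\ continuous f, f @` `[0, 1]%classic = K,
    forall A, convex_fibers_over A f 0 1 &
    (exists x y, [/\ K x, K y & x <> y]) -> injective_on f 0 1].
Proof.
move=> [_ aX] sK KT.
have [Knd|Kd] := pselect (exists x y, [/\ K x, K y & x <> y]).
  have [f [cf fK If]] := arc_path (aX K sK KT Knd).
  exists f; split=> // A s t u s0 st tu u1 fsu _.
  have su : s = u by apply: If => //; lra.
  by congr f; lra.
have [[x Kx] _ _] := sK; exists (fun=> x); split=> //; first by move=> t; exact: cst_continuous.
apply/seteqP; split=> [_ [t _ <-]//|y Ky]; exists 0.
  by rewrite /= in_itv /= lexx ler01.
by apply: contrapT => xy; apply: Kd; exists x, y.
Qed.

End paths.

Lemma glue_continuous (R : realType) (Z : topologicalType) (f g : R -> Z)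
    (a : R) : continuous f -> continuous g -> f a = g a ->
  continuous (fun t => if t <= a then f t else g t).
Proof.
move=> cf cg fg t U /= Ut; rewrite nbhs_simpl /=.
have [ta|ta|ta] := ltgtP t a.
- rewrite (ltW ta) in Ut.
  have h1 : \forall s \near t, s < a by exact: lt_nbhsl.
  have h2 : \forall s \near t, U (f s) by exact: (cf t U Ut).
  by apply: filterS2 h1 h2 => s /ltW sa Us /=; rewrite sa.
- rewrite leNgt ta /= in Ut.
  have h1 : \forall s \near t, a < s by exact: lt_nbhsr.
  have h2 : \forall s \near t, U (g s) by exact: (cg t U Ut).
  by apply: filterS2 h1 h2 => s; rewrite ltNge => /negbTE sa Us /=; rewrite sa.
- rewrite ta lexx in Ut; rewrite ta; have Ug := Ut; rewrite fg in Ug.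
  have h1 : \forall s \near a, U (f s) by exact: (cf a U Ut).
  have h2 : \forall s \near a, U (g s) by exact: (cg a U Ug).
  by apply: filterS2 h1 h2 => s Us Vs /=; case: ifP.
Qed.

(** * Rays running around a circle or back and forth along an arc *)

Section periodic_extension.
Context {R : realType} {Z : topologicalType}.
Variable c : R -> Z.
Hypotheses (cc : continuous c) (c02 : c 0 = c 2).

Definition periodic_ext (t : R) : Z := c (t - 2 * (Num.floor (t / 2))%:~R).

Lemma floor_half (k : int) (t : R) : 2 * k%:~R <= t < 2 * k%:~R + 2 ->
  Num.floor (t / 2) = k.
Proof.
by move=> kt; apply/eqP; rewrite floor_eq intrD; lra.
Qed.

Lemma floor_half_itv (t : R) :
  2 * (Num.floor (t / 2))%:~R <= t < 2 * (Num.floor (t / 2))%:~R + 2.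
Proof. by have := floor_itv (t / 2); rewrite intrD; lra. Qed.

Lemma periodic_extE (k : int) (t : R) : 0 <= t <= 2 ->
  periodic_ext (2 * k%:~R + t) = c t.
Proof.
move=> /andP[t0]; rewrite le_eqVlt => /orP[/eqP ->|t2]; last first.
  by rewrite /periodic_ext (floor_half (k := k)); [congr c|]; lra.
by rewrite /periodic_ext (floor_half (k := k + 1)) intrD; [rewrite -c02; congr c|]; lra.
Qed.

Lemma periodic_ext_continuous : continuous periodic_ext.
Proof.
move=> t U /= Ut; rewrite nbhs_simpl /=.
set k := Num.floor (t / 2); have kt := floor_half_itv t; rewrite -/k in kt.
have Uc : nbhs (c (t - 2 * k%:~R)) U by [].
have cs (v : R) : continuous (fun s : R => c (s + v)).
  move=> s; apply: continuous_comp; last exact: cc.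
  by apply: continuousD; [exact: cvg_id|exact: cst_continuous].
have lo : \forall s \near t, U (c (s - 2 * k%:~R)) by exact: (cs _ t U Uc).
have hi : \forall s \near t, s < 2 * k%:~R + 2.
  by apply: lt_nbhsl; case/andP: kt.
have [tk|tk] := eqVneq t (2 * k%:~R); last first.
  have gt : \forall s \near t, 2 * k%:~R < s.
    by apply: lt_nbhsr; rewrite lt_neqAle eq_sym tk; case/andP: kt.
  apply: filterS3 lo hi gt => s Us s1 s2 /=.
  by rewrite /periodic_ext (floor_half (k := k))// (ltW s2).
(* At an even parameter the points to the left belong to the previous period, where [c] is close to
   [c 2], and this is [c 0]. *)
have Uc2 : nbhs (c (t + (2 - 2 * k%:~R))) U.
  rewrite (_ : t + _ = 2); last by lra.
  by move: Uc; rewrite {1}tk subrr c02.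
have lo2 : \forall s \near t, U (c (s + (2 - 2 * k%:~R))) by exact: (cs _ t U Uc2).
have gt : \forall s \near t, 2 * k%:~R - 2 < s by apply: lt_nbhsr; lra.
apply: filterS3 (filterI lo lo2) hi gt => s [Us1 Us2] s1 s2 /=.
have [sk|sk] := leP (2 * k%:~R) s.
  by rewrite /periodic_ext (floor_half (k := k))// sk.
rewrite /periodic_ext (floor_half (k := k - 1)) ?intrB; last by lra.
by rewrite (_ : s - _ = s + (2 - 2 * k%:~R)) //; lra.
Qed.

Lemma periodic_extD2 t : periodic_ext (t + 2) = periodic_ext t.
Proof.
have := floor_half_itv t; rewrite /periodic_ext; set k := Num.floor (t / 2) => kt.
by rewrite (floor_half (k := k + 1)) intrD; [congr c|]; lra.
Qed.

Lemma periodic_ext_surj z (a : R) : (exists2 t, 0 <= t <= 2 & c t = z) ->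
  exists2 t, t <= a < t + 2 & periodic_ext t = z.
Proof.
move=> [u u02 uz]; have := floor_half_itv (a - u).
set k := Num.floor _ => ku; exists (2 * k%:~R + u); first by lra.
by rewrite periodic_extE.
Qed.

Lemma periodic_ext_inj s t :
  (forall u v, 0 <= u < 2 -> 0 <= v < 2 -> c u = c v -> u = v) ->
  periodic_ext s = periodic_ext t -> s <= t <= s + 2 -> t = s \/ t = s + 2.
Proof.
move=> cI st lst; have h1 := floor_half_itv s; have h2 := floor_half_itv t.
move/cI: st; move: h1 h2.
set k := Num.floor (s / 2); set m := Num.floor (t / 2) => h1 h2 st.
have {}st : s - 2 * k%:~R = t - 2 * m%:~R by apply: st; lra.
have [km mk] : k <= m /\ m <= k + 1.
  by rewrite -(ler_int R) -[m <= _](ler_int R) intrD; lra.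
have [mE|mE] : m = k \/ m = k + 1 by lia.
  by left; rewrite mE in st; lra.
by right; rewrite mE intrD in st; lra.
Qed.

End periodic_extension.

Section loop_rays.
Context {R : realType} {X : metricType R}.
Implicit Types f g : R -> X.

(** The return along [g] is reversed because [f] and [g] are used with a common start and a common
    end; [g = f] gives the walk back and forth along an arc. *)
Definition loop f g (t : R) : X := if t <= 1 then f t else g (2 - t).

Lemma loop_continuous f g : continuous f -> continuous g -> f 1 = g 1 ->
  continuous (loop f g).
Proof.
move=> cf cg fg1; apply: glue_continuous => //; last by rewrite fg1; congr g; lra.
move=> t; apply: continuous_comp; last exact: cg.
by apply: continuousB; [exact: cst_continuous|exact: cvg_id].
Qed.

Lemma loop02 f g : f 0 = g 0 -> loop f g 0 = loop f g 2.
Proof.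
by move=> fg0; rewrite /loop ler01 ifF ?subrr//; apply/negbTE; rewrite -ltNge; lra.
Qed.

Lemma loop_surj f g x : f 1 = g 1 ->
  (f @` `[0, 1]%classic `|` g @` `[0, 1]%classic) x ->
  exists2 t, 0 <= t <= 2 & loop f g t = x.
Proof.
move=> fg1 [] [t]; rewrite /= in_itv /= => t01 <-.
  by exists t; [lra|rewrite /loop; case/andP: t01 => _ ->].
exists (2 - t); first by lra.
rewrite /loop; case: ifPn => [t1|_]; last by congr g; lra.
have -> : t = 1 by lra.
by rewrite -fg1; congr f; lra.
Qed.

Lemma surjective_ray_dense (phi : R -> X) :
  (forall x (a : R), exists2 t, t <= a < t + 2 & phi t = x) ->
  forall x (e T : R), 0 < e -> exists2 t, T <= t & mdist x (phi t) < e.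
Proof.
move=> sphi x e T e0; have [t tT <-] := sphi x (T + 2).
by exists t; [lra|rewrite mdistxx].
Qed.

(** A proper [A] misses some [z], which the ray visits at [t <= a] and again at [t + 2 > a]. Hence
    [[a, b]] stays in the window [[t, t + 2]], where the only repeated value is [z], so the fibers
    over [A] are points and [lift_continuum] applies. *)
Lemma circle_ray f g : continuous f -> continuous g -> f 0 = g 0 -> f 1 = g 1 ->
  f @` `[0, 1]%classic `|` g @` `[0, 1]%classic = [set: X] ->
  injective_on f 0 1 -> injective_on g 0 1 ->
  (forall s t, 0 <= s <= 1 -> 0 <= t <= 1 -> f s = g t ->
    s = t /\ (s = 0 \/ s = 1)) ->
  exists phi : R -> X, lifting_ray phi.
Proof.
move=> cf cg fg0 fg1 fgT If Ig Ifg.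
have cl := loop_continuous cf cg fg1; have l02 := loop02 fg0.
pose phi := periodic_ext (loop f g).
have cphi : continuous phi by exact: periodic_ext_continuous.
have sphi x (a : R) : exists2 t, t <= a < t + 2 & phi t = x.
  by apply: periodic_ext_surj => //; apply: loop_surj => //; rewrite fgT.
have Il u v : 0 <= u < 2 -> 0 <= v < 2 -> loop f g u = loop f g v -> u = v.
  rewrite /loop => u2 v2; case: ifPn => u1; case: ifPn => v1.
  - by move=> /If; apply; lra.
  - by rewrite -ltNge in v1; move=> /Ifg[]; lra.
  - by rewrite -ltNge in u1; move=> /esym/Ifg[]; lra.
  - by rewrite -!ltNge in u1 v1; move=> /Ig uv; have := uv _ _; lra.
exists phi; split=> //; first exact: surjective_ray_dense.
move=> a b A ab sA AT Aab.
have [z Az] : exists z, ~ A z.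
  by apply/existsNP => h; apply: AT; apply/seteqP; split.
have [t ta tz] := sphi z a.
have t2z : phi (t + 2) = z by rewrite /phi periodic_extD2.
have bt : b < t + 2.
  rewrite ltNge; apply/negP => tb; apply: Az; rewrite -t2z; apply: Aab; lra.
have [c [d [/andP[_ ca] /andP[bd _] H1 H2]]] : exists c d, [/\ t <= c <= a,
    b <= d <= t + 2, forall t, c <= t <= d -> A (phi t) &
    A `<=` phi @` `[c, d]%classic].
  apply: lift_continuum => //; [| |lra|lra].
  - move=> x _; have [u ut ux] := sphi x (t + 2); exists u => //=.
    rewrite in_itv /=; lra.
  - have [_ _ kA] := sA; move=> s v u ts sv vu ut; apply: convex_preimage ts sv vu ut => //.
      by move=> x _; have [w wt wx] := sphi x (t + 2); exists w; rewrite //= in_itv /=; lra.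
    move=> {}s {}v {}u ts sv vu ut su As.
    have [us|us] : u = s \/ u = s + 2 by apply: (periodic_ext_inj Il su); lra.
      by congr phi; lra.
    by exfalso; apply: Az; rewrite -tz (_ : t = s) //; lra.
by exists c, d.
Qed.

(* Two consecutive passes of the ray through X, starting and ending at h 0. *)
Lemma tent_lift (phi h : R -> X) (m a b : R) (A : set X) :
  continuous phi -> continuous h -> h @` `[0, 1]%classic = [set: X] ->
  convex_fibers_over A h 0 1 ->
  (forall t : R, 0 <= t <= 1 -> phi (m + t) = h t) ->
  (forall t : R, 0 <= t <= 1 -> phi (m + 2 - t) = h t) ->
  subcontinuum A -> ~ A (h 0) -> m <= a < m + 2 -> a <= b ->
  (forall t, a <= t <= b -> A (phi t)) ->
  exists c d, [/\ c <= a, b <= d, forall t, c <= t <= d -> A (phi t) &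
    A `<=` phi @` `[c, d]%classic].
Proof.
move=> cphi ch hT Ch hl hr sA A0 ma ab Aab.
have [A0' _ kA] := sA.
have h0E : phi (m + 2) = h 0 by rewrite -(hr 0) ?lexx ?ler01// subr0.
have bm : b < m + 2.
  by rewrite ltNge; apply/negP => tb; apply: A0; rewrite -h0E; apply: Aab; lra.
have Ah : A `<=` h @` `[0, 1]%classic by rewrite hT.
have cvh (s t u : R) : 0 <= s -> s <= t -> t <= u -> u <= 1 -> A (h s) -> A (h u) -> A (h t).
  by move=> s0 st tu u1; exact: (convex_preimage ch kA Ah Ch s0 st tu u1).
have lift (l r : R) : l <= a -> b <= r -> A `<=` phi @` `[l, r]%classic ->
    (forall s t u, l <= s -> s <= t -> t <= u -> u <= r ->
      A (phi s) -> A (phi u) -> A (phi t)) ->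
    exists c d, [/\ c <= a, b <= d, forall t, c <= t <= d -> A (phi t) &
    A `<=` phi @` `[c, d]%classic].
  move=> la br AS cv.
  have [c [d [/andP[_ ca] /andP[bd _] H1 H2]]] := lift_continuum cphi sA AS cv la ab br Aab.
  by exists c, d.
have lE (t : R) : m <= t <= m + 1 -> phi t = h (t - m).
  by move=> mt; rewrite -hl; [congr phi|]; lra.
have rE (t : R) : m + 1 <= t <= m + 2 -> phi t = h (m + 2 - t).
  by move=> mt; rewrite -hr; [congr phi|]; lra.
have Sl : A `<=` phi @` `[m, m + 1]%classic.
  move=> x /Ah[t]; rewrite /= in_itv /= => t01 <-; exists (m + t); last exact: hl.
  by rewrite /= in_itv /=; lra.
have Sr : A `<=` phi @` `[m + 1, m + 2]%classic.
  move=> x /Ah[t]; rewrite /= in_itv /= => t01 <-; exists (m + 2 - t); last exact: hr.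
  by rewrite /= in_itv /=; lra.
have cvl (s t u : R) : m <= s -> s <= t -> t <= u -> u <= m + 1 ->
    A (phi s) -> A (phi u) -> A (phi t).
  by move=> ms st tu um; rewrite (lE s) ?(lE t) ?(lE u); [apply: cvh; lra|lra|lra|lra].
have cvr (s t u : R) : m + 1 <= s -> s <= t -> t <= u -> u <= m + 2 ->
    A (phi s) -> A (phi u) -> A (phi t).
  by move=> ms st tu um; rewrite (rE s) ?(rE t) ?(rE u); [move=> As Au; apply: cvh Au As; lra|lra|lra|lra].
(* [h 1] is the turning point, at parameter [m + 1]. If [A] contains it, the preimages of [A] in the
   two passes are intervals that meet there; if not, [[a, b]] cannot cross [m + 1] and a single pass
   is enough. *)
have [A1|A1] := pselect (A (h 1)).
  apply: (lift m (m + 2)); [lra|lra| |].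
    by apply: subset_trans Sl _; apply: image_subset => t /=; rewrite !in_itv/=; lra.
  have up (t : R) : m <= t <= m + 1 -> A (phi t) -> forall v : R, t <= v <= m + 1 -> A (phi v).
    by move=> mt + v tv; rewrite (lE t) ?(lE v); [move=> At; apply: (cvh (t - m) _ 1 _ _ _ _ At A1); lra|lra|lra].
  have dn (t : R) : m + 1 <= t <= m + 2 -> A (phi t) -> forall v : R, m + 1 <= v <= t -> A (phi v).
    by move=> mt + v tv; rewrite (rE t) ?(rE v); [move=> At; apply: (cvh (m + 2 - t) _ 1 _ _ _ _ At A1); lra|lra|lra].
  move=> s t u ms st tu um As Au.
  have [tm|tm] := leP t (m + 1).
    by apply: (up s) => //; lra.
  by apply: (dn u) => //; lra.
have nm1 : phi (m + 1) = h 1 by apply: hl; rewrite ler01 lexx.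
have [bm1|bm1] := leP b (m + 1).
  by apply: (lift m (m + 1)) => //; lra.
have [am1|am1] := leP a (m + 1); last by apply: (lift (m + 1) (m + 2)) => //; lra.
by exfalso; apply: A1; rewrite -nm1; apply: Aab; lra.
Qed.

(** A proper [A] misses [f 0] or [f 1], since by convexity it would otherwise be everything. The
    window for [[a, b]] consists of two passes that start and end at a missed end; for [f 1] it
    begins at an odd parameter and [f] is read backwards. *)
Lemma arc_ray f : continuous f -> f @` `[0, 1]%classic = [set: X] ->
  (forall A, convex_fibers_over A f 0 1) -> exists phi : R -> X, lifting_ray phi.
Proof.
move=> cf fT Cf.
have cl := loop_continuous cf cf erefl; have l02 := loop02 (erefl (f 0)).
pose phi := periodic_ext (loop f f).
have cphi : continuous phi by exact: periodic_ext_continuous.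
have sphi x (a : R) : exists2 t, t <= a < t + 2 & phi t = x.
  by apply: periodic_ext_surj => //; apply: loop_surj => //; rewrite fT setUid.
have pl (k : int) (t : R) : 0 <= t <= 1 -> phi (2 * k%:~R + t) = f t.
  move=> t01; rewrite /phi periodic_extE ?/loop//; last lra.
  by case/andP: t01 => _ ->.
have pr (k : int) (t : R) : 0 <= t <= 1 -> phi (2 * k%:~R + 2 - t) = f t.
  move=> t01; rewrite -addrA /phi periodic_extE ?/loop//; last lra.
  by case: ifPn => h; congr f; lra.
exists phi; split=> //; first exact: surjective_ray_dense.
move=> a b A ab sA AT Aab; have [_ _ kA] := sA.
have [A0|A0] := pselect (A (f 0)); last first.
  have := floor_half_itv a; set k := Num.floor _ => ka.
  exact: (tent_lift cphi cf fT (Cf A) (pl k) (pr k) sA A0 ka ab Aab).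
have A1 : ~ A (f 1).
  move=> A1; apply: AT; apply/seteqP; split=> // x _.
  have : (f @` `[0, 1]%classic) x by rewrite fT.
  move=> [t]; rewrite /= in_itv /= => /andP[t0 t1] <-.
  by apply: (convex_preimage cf kA _ (Cf A) (lexx 0) t0 t1 (lexx 1)) => //; rewrite fT.
have := floor_half_itv (a - 1); set k := Num.floor _ => ka.
apply: (tent_lift (h := fun t => f (1 - t)) (m := 2 * k%:~R + 1)) => //.
- move=> t; apply: continuous_comp; last exact: cf.
  by apply: continuousB; [exact: cst_continuous|exact: cvg_id].
- apply/seteqP; split=> // x _; have : (f @` `[0, 1]%classic) x by rewrite fT.
  move=> [t]; rewrite /= in_itv /= => t01 <-; exists (1 - t); last by congr f; lra.
  by rewrite /= in_itv /=; lra.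
- move=> s t u s0 st tu u1 su As; rewrite su in As *.
  by apply: (Cf A (1 - u) (1 - t) (1 - s) _ _ _ _ (esym su) As); lra.
- by move=> t t01; rewrite -(pr k); [congr phi|]; lra.
- move=> t t01; rewrite -(pl (k + 1)) ?intrD; [congr phi|]; lra.
- by rewrite subr0.
- by lra.
Qed.

End loop_rays.

(** * Decomposable arc continua *)

Section affine_paths.
Context {R : realType} {X : metricType R}.
Implicit Types f g : R -> X.

Definition affine_path f (x y t : R) : X := f (x + t * (y - x)).

Lemma affine_path0 f x y : affine_path f x y 0 = f x.
Proof. by rewrite /affine_path mul0r addr0. Qed.

Lemma affine_path1 f x y : affine_path f x y 1 = f y.
Proof. by rewrite /affine_path mul1r addrC subrK. Qed.

Lemma affine_path_continuous f x y : continuous f -> continuous (affine_path f x y).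
Proof.
move=> cf t; apply: continuous_comp; last exact: cf.
apply: continuousD; first exact: cst_continuous.
by apply: continuousM; [exact: cvg_id|exact: cst_continuous].
Qed.

Lemma affine_path_itv (x y t l r : R) : l <= x <= r -> l <= y <= r -> 0 <= t <= 1 ->
  l <= x + t * (y - x) <= r.
Proof.
move=> /andP[lx xr] /andP[ly yr] /andP[t0 t1].
have h1 : 0 <= t * (y - l) by apply: mulr_ge0 => //; lra.
have h2 : 0 <= (1 - t) * (x - l) by apply: mulr_ge0 => //; lra.
have h3 : 0 <= t * (r - y) by apply: mulr_ge0 => //; lra.
have h4 : 0 <= (1 - t) * (r - x) by apply: mulr_ge0 => //; lra.
by apply/andP; split; nra.
Qed.

Lemma affine_path_inj f x y l r : x != y -> l <= x <= r -> l <= y <= r ->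
  injective_on f l r -> injective_on (affine_path f x y) 0 1.
Proof.
move=> xy xlr ylr If s t s01 t01 /If st.
have {}st : x + s * (y - x) = x + t * (y - x) by apply: st; exact: affine_path_itv.
have yx : y - x != 0 by rewrite subr_eq0 eq_sym.
by apply: (mulIf yx); lra.
Qed.

Lemma affine_path_image f x y : x <= y ->
  affine_path f x y @` `[0, 1]%classic = f @` `[x, y]%classic.
Proof.
rewrite le_eqVlt => /orP[/eqP <-|xy].
  apply/seteqP; split=> [_ [t _ <-]|_ [t + <-]].
    exists x; first by rewrite /= in_itv /= lexx.
    by rewrite /affine_path subrr mulr0 addr0.
  rewrite /= in_itv /= => /andP[h1 h2]; exists 0; first by rewrite /= in_itv /= lexx ler01.
  by rewrite affine_path0; congr f; lra.
apply/seteqP; split=> [_ [t + <-]|_ [t + <-]]; rewrite /= in_itv /= => t01.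
  exists (x + t * (y - x)) => //=; rewrite in_itv /=.
  by apply: affine_path_itv => //; lra.
exists ((t - x) / (y - x)).
  by rewrite /= in_itv /= divr_ge0 ?ler_pdivrMr; lra.
rewrite /affine_path divfK ?subr_eq0 ?gt_eqF//; congr f; lra.
Qed.

Lemma affine_path_rev_image f :
  affine_path f 1 0 @` `[0, 1]%classic = f @` `[0, 1]%classic.
Proof.
apply/seteqP; split=> _ [t + <-]; rewrite /= in_itv /= => t01.
  by exists (1 + t * (0 - 1)) => //=; rewrite in_itv /=; lra.
exists (1 - t); first by rewrite /= in_itv /=; lra.
by rewrite /affine_path; congr f; lra.
Qed.

(** The two paths meet only at the junction, so running through both at double speed is an injective
    path onto [X]. *)
Lemma concat_ray g f : continuous g -> continuous f -> g 1 = f 0 ->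
  injective_on g 0 1 -> injective_on f 0 1 ->
  (forall s t, 0 <= s <= 1 -> 0 <= t <= 1 -> g s = f t -> s = 1 /\ t = 0) ->
  g @` `[0, 1]%classic `|` f @` `[0, 1]%classic = [set: X] ->
  exists phi : R -> X, lifting_ray phi.
Proof.
move=> cg cf gf Ig If Igf gfT.
pose h t := if t <= 2^-1 then affine_path g 0 2 t else affine_path f (-1) 1 t.
have gE t : affine_path g 0 2 t = g (2 * t) by rewrite /affine_path; congr g; lra.
have fE t : affine_path f (-1) 1 t = f (2 * t - 1) by rewrite /affine_path; congr f; lra.
have Ih : injective_on h 0 1.
  move=> s t s01 t01; rewrite /h !gE !fE.
  case: ifPn => s2; case: ifPn => t2.
  - by move=> /Ig st; have := st _ _; lra.
  - by rewrite -ltNge in t2; move=> /Igf[]; lra.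
  - by rewrite -ltNge in s2; move=> /esym/Igf[]; lra.
  - by rewrite -!ltNge in s2 t2; move=> /If st; have := st _ _; lra.
apply: (@arc_ray _ _ h).
- apply: glue_continuous; [exact: affine_path_continuous..|].
  by rewrite gE fE mulfV // gf; congr f; lra.
- apply/seteqP; split=> // x _.
  have : (g @` `[0, 1]%classic `|` f @` `[0, 1]%classic) x by rewrite gfT.
  move=> [] [t]; rewrite /= in_itv /= => t01 <-.
    exists (t / 2); first by rewrite /= in_itv /=; lra.
    by rewrite /h ifT; [rewrite gE; congr g|]; lra.
  have [t0|t0] := eqVneq t 0.
    exists 2^-1; first by rewrite /= in_itv /=; lra.
    by rewrite /h lexx gE mulfV// gf t0.
  have {}t0 : 0 < t by rewrite lt_neqAle eq_sym t0; case/andP: t01.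
  exists ((t + 1) / 2); first by rewrite /= in_itv /=; lra.
  by rewrite /h ifF; [rewrite fE; congr f|apply/negbTE; rewrite -ltNge]; lra.
- move=> A s t u s0 st tu u1 su _; have su' : s = u by apply: Ih => //; lra.
  by congr h; lra.
Qed.

End affine_paths.

(** * Unions of subcontinua that fit into an arc *)

Section proper_subcontinua.
Context {R : realType} {X : metricType R}.
Implicit Types (P Q C K : set X).

Lemma subcontinuumU P Q : subcontinuum P -> subcontinuum Q -> P `&` Q !=set0 ->
  subcontinuum (P `|` Q).
Proof.
move=> [[x Px] cP kP] [_ cQ kQ] PQ; split; first by exists x; left.
  exact: compactU.
exact: connectedU.
Qed.

Hypothesis aX : arc_continuum X.

(** If the union were proper it would lie on a path with convex fibers. The parameters of [P] and of
    [Q] would then be convex, so the path from [a] to [b] would stay in both sets, that is, in the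
    two points [a] and [b], against connectedness. *)
Lemma two_point_intersection P Q a b : subcontinuum P -> subcontinuum Q ->
  P a -> Q a -> P b -> Q b -> a <> b ->
  (forall x, P x -> Q x -> x = a \/ x = b) -> P `|` Q = [set: X].
Proof.
move=> sP sQ Pa Qa Pb Qb ab PQ; apply: contrapT => PQT.
have [|k [ck kE Ck _]] := proper_subcontinuum_path aX (subcontinuumU sP sQ _) PQT.
  by exists a.
wlog [p [q [p0 pq q1 kp kq]]] : a b Pa Qa Pb Qb ab PQ / exists p q,
    [/\ 0 <= p, p <= q, q <= 1, k p = a & k q = b].
  move=> H.
  have [p] : (k @` `[0, 1]%classic) a by rewrite kE; left.
  rewrite /= in_itv /= => /andP[p0 p1] ka.
  have [q] : (k @` `[0, 1]%classic) b by rewrite kE; left.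
  rewrite /= in_itv /= => /andP[q0 q1] kb.
  have [pq|qp] := leP p q; first by apply: (H a b) => //; exists p, q.
  apply: (H b a) => //; [exact: nesym|by move=> x Px /(PQ x Px)[]; [right|left]|].
  by exists q, p; split=> //; exact: ltW.
have kab t : p <= t <= q -> k t = a \/ k t = b.
  move=> /andP[pt tq]; have [[_ _ kP] [_ _ kQ]] := (sP, sQ); apply: PQ.
    by apply: (convex_preimage ck kP _ (Ck P) p0 pt tq q1); rewrite ?kp ?kq ?kE//; left.
  by apply: (convex_preimage ck kQ _ (Ck Q) p0 pt tq q1); rewrite ?kp ?kq ?kE//; right.
have c1 (x : X) : closed [set x].
  by apply: accessible_closed_set1; apply: hausdorff_accessible; exact: metric_hausdorff.
have [|||x [[_ ->]]] := connected_closed_cover (path_image_connected (l := p) (r := q) ck) (c1 a) (c1 b).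
- by move=> _ [t + <-]; rewrite /= in_itv /= => /kab[->|->]; [left|right].
- by exists a; split=> //; exists p => //; rewrite /= in_itv /= lexx.
- by exists b; split=> //; exists q => //; rewrite /= in_itv /= lexx andbT.
- exact: ab.
Qed.

(** Otherwise each of the three sets has a point of its own. On the path through the proper union,
    two of these points are on the same side of [z], and the one nearer to [z] belongs to the set of
    the other by convexity. *)
Lemma atriodic P Q C z : subcontinuum P -> subcontinuum Q -> subcontinuum C ->
  P z -> Q z -> C z -> P `|` Q `|` C <> [set: X] ->
  [\/ P `<=` Q `|` C, Q `<=` P `|` C | C `<=` P `|` Q].
Proof.
move=> sP sQ sC Pz Qz Cz PQCT; apply: contrapT => nPQC.
have nP : ~ (P `<=` Q `|` C) by move=> ?; apply: nPQC; constructor 1.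
have nQ : ~ (Q `<=` P `|` C) by move=> ?; apply: nPQC; constructor 2.
have nC : ~ (C `<=` P `|` Q) by move=> ?; apply: nPQC; constructor 3.
have sPQC : subcontinuum (P `|` Q `|` C).
  apply: subcontinuumU => //; last by exists z; split=> //; left.
  by apply: subcontinuumU => //; exists z.
have [k [ck kE Ck _]] := proper_subcontinuum_path aX sPQC PQCT.
have pt x : (P `|` Q `|` C) x -> exists2 t, 0 <= t <= 1 & k t = x.
  by rewrite -kE => -[t]; rewrite /= in_itv /=; exists t.
have [z' z'01 kz] : exists2 t, 0 <= t <= 1 & k t = z by apply: pt; right.
move: nP => /existsNP[p /not_implyP[Pp /not_orP[nQp nCp]]].
move: nQ => /existsNP[q /not_implyP[Qq /not_orP[nPq nCq]]].
move: nC => /existsNP[c /not_implyP[Cc /not_orP[nPc nQc]]].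
have [p' p01 kp] : exists2 t, 0 <= t <= 1 & k t = p by apply: pt; left; left.
have [q' q01 kq] : exists2 t, 0 <= t <= 1 & k t = q by apply: pt; left; right.
have [c' c01 kc] : exists2 t, 0 <= t <= 1 & k t = c by apply: pt; right.
have sep D s t : subcontinuum D -> D `<=` P `|` Q `|` C -> 0 <= s <= 1 -> D z ->
    D (k s) -> ~ D (k t) -> ~ (s <= t <= z') /\ ~ (z' <= t <= s).
  move=> [_ _ kD] DK s01 Dz Ds Dt; split=> tz; apply: Dt.
    apply: (@convex_preimage _ _ D k 0 1 s t z') => //; rewrite ?kz ?kE//; lra.
  apply: (@convex_preimage _ _ D k 0 1 z' t s) => //; rewrite ?kz ?kE//; lra.
have PK : P `<=` P `|` Q `|` C by move=> x; left; left.
have QK : Q `<=` P `|` Q `|` C by move=> x; left; right.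
have CK : C `<=` P `|` Q `|` C by move=> x; right.
rewrite -kp in Pp nQp nCp; rewrite -kq in Qq nPq nCq; rewrite -kc in Cc nPc nQc.
have opp D E s t : subcontinuum D -> subcontinuum E -> D `<=` P `|` Q `|` C ->
    E `<=` P `|` Q `|` C -> 0 <= s <= 1 -> 0 <= t <= 1 -> D z -> E z ->
    D (k s) -> ~ E (k s) -> E (k t) -> ~ D (k t) -> (s <= z') = (t <= z') -> False.
  move=> sD sE DK EK s01 t01 Dz Ez Ds nEs Et nDt.
  have [d1 d2] := sep D s t sD DK s01 Dz Ds nDt.
  have [e1 e2] := sep E t s sE EK t01 Ez Et nEs.
  have [sz|sz] := leP s z' => tz; have [st|ts] := leP s t.
  - by apply: d1; rewrite st -tz.
  - by apply: e1; rewrite (ltW ts) sz.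
  - by apply: e2; rewrite (ltW sz) st.
  - by apply: d2; rewrite (ltW ts) andbT ltW// ltNge -tz.
have h1 := opp P Q p' q' sP sQ PK QK p01 q01 Pz Qz Pp nQp Qq nPq.
have h2 := opp P C p' c' sP sC PK CK p01 c01 Pz Cz Pp nCp Cc nPc.
have h3 := opp Q C q' c' sQ sC QK CK q01 c01 Qz Cz Qq nCq Cc nQc.
by move: h1 h2 h3; case: (p' <= z'); case: (q' <= z'); case: (c' <= z') => h1 h2 h3;
  by [apply: h1|apply: h2|apply: h3].
Qed.

End proper_subcontinua.

Section decomposable.
Context {R : realType} {X : metricType R}.
Hypothesis aX : arc_continuum X.
Implicit Types (A B : set X) (f g : R -> X).

Let kX : connected [set: X] := let: conj (And3 _ k _) _ := aX in k.

Lemma cover_meets A B : subcontinuum A -> subcontinuum B ->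
  A `|` B = [set: X] -> A `&` B !=set0.
Proof.
move=> [A0 cA _] [B0 cB _] AB.
have [|||x [[_ Ax] Bx]] := connected_closed_cover kX (compact_metric_closed cA)
  (compact_metric_closed cB); last by exists x.
- by rewrite AB.
- by rewrite setTI.
- by rewrite setTI.
Qed.

(** Around [t0] the path leaves [B] at a last parameter [x] and returns at a first parameter [y].
    Its piece over [[x, y]] meets the subarc of [B] from [f x] to [f y] exactly in these two points,
    so by [two_point_intersection] both together are [X], and they form a circle. *)
Lemma circle_case B f g (t0 : R) : subcontinuum B ->
  continuous f -> continuous g -> injective_on f 0 1 -> injective_on g 0 1 ->
  g @` `[0, 1]%classic = B -> B (f 0) -> B (f 1) -> 0 <= t0 <= 1 -> ~ B (f t0) ->
  exists phi : R -> X, lifting_ray phi.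
Proof.
move=> sB cf cg If Ig gB B0 B1 t01 nB.
have cB : closed B by apply: compact_metric_closed; case: sB.
pose J l r := `[l, r]%classic `&` f @^-1` B.
have cJ l r : compact (J l r).
  apply: compact_closedI; first exact: segment_compact.
  by apply: preimage_closed.
have cid K : {within K, continuous (fun t : R => t)}.
  by apply: continuous_subspaceT => t; exact: cvg_id.
have [|x /set_mem[+ Bx] xmax] := compact_EVT_max _ (cJ 0 t0) (cid _).
  by exists 0; split=> //=; rewrite in_itv /= lexx; case/andP: t01.
have [|y /set_mem[+ By] ymin] := compact_EVT_min _ (cJ t0 1) (cid _).
  by exists 1; split=> //=; rewrite in_itv /= lexx andbT; case/andP: t01.
rewrite /= !in_itv /= => /andP[ty y1] /andP[x0 xt].
have {}xt : x < t0 by rewrite lt_neqAle xt andbT; apply/eqP => xE; rewrite -xE in nB.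
have {}ty : t0 < y by rewrite lt_neqAle ty andbT; apply/eqP => yE; rewrite yE in nB.
have gap t : x < t < y -> ~ B (f t).
  move=> /andP[xlt tly] Bt; have [tt|tt] := leP t t0.
    have : t <= x by apply: xmax; rewrite inE; split=> //=; rewrite in_itv /=; lra.
    by rewrite leNgt xlt.
  have : y <= t by apply: ymin; rewrite inE; split=> //=; rewrite in_itv /=; lra.
  by rewrite leNgt tly.
have xy : x != y by rewrite lt_eqF// (lt_trans xt).
pose F := affine_path f x y.
have cF : continuous F by exact: affine_path_continuous.
have IF : injective_on F 0 1 by apply: (affine_path_inj xy _ _ If); lra.
have FB u : 0 <= u <= 1 -> B (F u) -> u = 0 \/ u = 1.
  move=> u01 BFu; have [->|u0] := eqVneq u 0; first by left.
  have [->|u1] := eqVneq u 1; first by right.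
  have u01' : 0 < u < 1 by rewrite !lt_neqAle eq_sym u0 u1.
  exfalso; apply: gap BFu; have yx : 0 < y - x by lra.
  have h1 : 0 < u * (y - x) by apply: mulr_gt0 => //; lra.
  have h2 : 0 < (1 - u) * (y - x) by apply: mulr_gt0 => //; lra.
  by apply/andP; split; lra.
have in01 (t : R) : 0 <= t <= 1 -> `[0, 1]%classic t by rewrite /= in_itv.
have F01 t : 0 <= t <= 1 -> (F @` `[0, 1]%classic) (F t) by move=> t1; exists t => //; exact: in01.
have sF : subcontinuum (F @` `[0, 1]%classic) by apply: path_image_subcontinuum.
have Fx : F 0 = f x by exact: affine_path0.
have Fy : F 1 = f y by exact: affine_path1.
have fxy : f x <> f y.
  by move=> /If h; move: xy; rewrite h ?eqxx//; lra.
have [s] : (g @` `[0, 1]%classic) (f x) by rewrite gB.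
rewrite /= in_itv /= => s01 gs.
have [s'] : (g @` `[0, 1]%classic) (f y) by rewrite gB.
rewrite /= in_itv /= => s01' gs'.
have ss : s != s' by apply/eqP => E; apply: fxy; rewrite -gs -gs' E.
pose G := affine_path g s s'.
have cG : continuous G by exact: affine_path_continuous.
have IG : injective_on G 0 1 by apply: (affine_path_inj ss _ _ Ig); lra.
have Gx : G 0 = f x by rewrite /G affine_path0.
have Gy : G 1 = f y by rewrite /G affine_path1.
have GB u : 0 <= u <= 1 -> B (G u).
  by move=> u01; rewrite -gB; exists (s + u * (s' - s)) => //; apply: in01; exact: affine_path_itv.
have G01 t : 0 <= t <= 1 -> (G @` `[0, 1]%classic) (G t) by move=> t1; exists t => //; exact: in01.
have sG : subcontinuum (G @` `[0, 1]%classic) by apply: path_image_subcontinuum.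
apply: (circle_ray cF cG) => //; first by rewrite Gx.
- by rewrite Gy.
- apply: (two_point_intersection aX sF sG (a := f x) (b := f y)) => //.
  + by rewrite -Fx; apply: F01; lra.
  + by rewrite -Gx; apply: G01; lra.
  + by rewrite -Fy; apply: F01; lra.
  + by rewrite -Gy; apply: G01; lra.
  + move=> _ [u + <-] [v + vu]; rewrite /= !in_itv /= => u01 v01.
    by have [->|->] : u = 0 \/ u = 1; [apply: FB => //; rewrite -vu; exact: GB|left|right].
- move=> u v u01 v01 uv; have u01' : u = 0 \/ u = 1 by apply: FB => //; rewrite uv; exact: GB.
  split=> //; case: u01' uv => ->.
    by rewrite Fx -Gx => /IG; apply=> //; lra.
  by rewrite Fy -Gy => /IG; apply=> //; lra.
Qed.

(** After its last parameter [y] in [B], the path [f] has a tail that meets the rest of [X] only in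
    [f y]. The rest is an arc [g]; if [f y] is an end of [g] the two concatenate, and if it is
    interior there is a triod. *)
Lemma arc_case A B f : subcontinuum B ->
  (exists x y, [/\ B x, B y & x <> y]) -> A `&` B !=set0 ->
  A `|` B = [set: X] -> f @` `[0, 1]%classic = A ->
  continuous f -> injective_on f 0 1 -> ~ B (f 1) ->
  exists phi : R -> X, lifting_ray phi.
Proof.
move=> sB Bnd AB0 AB fA cf If nB1.
have cB : closed B by apply: compact_metric_closed; case: sB.
pose J := `[0, 1]%classic `&` f @^-1` B.
have cJ : compact J.
  apply: compact_closedI; first exact: segment_compact.
  by apply: preimage_closed.
have J0 : J !=set0.
  have [x [+ Bx]] := AB0; rewrite -fA => -[t t01 tx]; exists t; split=> //.
  by rewrite /= tx.
have cid : {within J, continuous (fun t : R => t)}.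
  by apply: continuous_subspaceT => t; exact: cvg_id.
have [y /set_mem[+ By] ymax] := compact_EVT_max J0 cJ cid.
rewrite /= in_itv /= => /andP[y0 y1].
have {}y1 : y < 1 by rewrite lt_neqAle y1 andbT; apply/eqP => yE; rewrite -yE in nB1.
have gap t : y < t <= 1 -> ~ B (f t).
  move=> /andP[yt t1] Bt; have : t <= y.
    by apply: ymax; rewrite inE; split=> //=; rewrite in_itv /= t1 andbT; lra.
  by rewrite leNgt yt.
(* The path may leave and enter [B] several times before [y]. The enlarged set remains proper, as it
   misses [f 1], so it is an arc. *)
pose B1 := B `|` f @` `[0, y]%classic.
have in01 (t : R) : 0 <= t <= 1 -> `[0, 1]%classic t by rewrite /= in_itv.
have B1y t : y < t <= 1 -> ~ B1 (f t).
  move=> yt [/gap|[s]]; first exact.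
  rewrite /= in_itv /= => sy /If st; have sE : s = t by apply: st; lra.
  by have : t <= y by [rewrite -sE; case/andP: sy]; rewrite leNgt; case/andP: yt => ->.
have sB1 : subcontinuum B1.
  apply: subcontinuumU => //; first exact: path_image_subcontinuum.
  by exists (f y); split=> //; exists y => //; rewrite /= in_itv /= y0 lexx.
have B1T : B1 <> [set: X].
  by move=> BT; apply: (B1y 1); [rewrite y1 lexx|rewrite BT].
have [g [cg gB _ Ig]] := proper_subcontinuum_path aX sB1 B1T.
have {}Ig : injective_on g 0 1.
  by apply: Ig; have [u [v [Bu Bv uv]]] := Bnd; exists u, v; split=> //; left.
pose F := affine_path f y 1.
have cF : continuous F by exact: affine_path_continuous.
have IF : injective_on F 0 1 by apply: (affine_path_inj _ _ _ If); rewrite ?lt_eqF//; lra.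
have F0 : F 0 = f y by exact: affine_path0.
have FB1 u : 0 <= u <= 1 -> B1 (F u) -> u = 0.
  move=> u01 BFu; have [//|u0] := eqVneq u 0.
  exfalso; apply: B1y BFu.
  have u0' : 0 < u by rewrite lt_neqAle eq_sym u0; case/andP: u01.
  have h1 : 0 < u * (1 - y) by apply: mulr_gt0 => //; lra.
  have h2 : 0 <= (1 - u) * (1 - y) by apply: mulr_ge0 => //; lra.
  by apply/andP; split; lra.
have FT : B1 `|` F @` `[0, 1]%classic = [set: X].
  apply/seteqP; split=> // x _; have : (A `|` B) x by rewrite AB.
  move=> [|Bx]; last by left; left.
  rewrite -fA => -[t]; rewrite /= in_itv /= => /andP[t0 t1] tx.
  have [ty|yt] := leP t y.
    by left; right; exists t => //; rewrite /= in_itv /= t0.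
  suff : (f @` `[y, 1]%classic) x.
    by rewrite -(affine_path_image f (ltW y1)) => ?; right.
  exists t => //.
  by rewrite /= in_itv /= (ltW yt).
have [w] : (g @` `[0, 1]%classic) (f y) by rewrite gB; left.
rewrite /= in_itv /= => w01 gw.
have gFw s t : 0 <= s <= 1 -> 0 <= t <= 1 -> g s = F t -> s = w /\ t = 0.
  move=> s01 t01 st; have t0 : t = 0.
    by apply: FB1 => //; rewrite -st -gB; exists s => //; exact: in01.
  by split=> //; apply: Ig => //; rewrite gw st t0.
have [wE|w1] := eqVneq w 1.
  apply: (concat_ray cg cF) => //; first by rewrite F0 -gw wE.
    by move=> s t s01 t01 /gFw[]//; rewrite wE.
  by rewrite gB.
have [wE|w0] := eqVneq w 0.
  apply: (concat_ray (g := affine_path g 1 0) (f := F)) => //.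
  - exact: affine_path_continuous.
  - by rewrite affine_path1 F0 -gw wE.
  - by apply: (affine_path_inj _ _ _ Ig); rewrite ?oner_neq0//; lra.
  - move=> s t s01 t01; rewrite /affine_path => /gFw[]//; first by lra.
    by rewrite wE => h1 h2; split=> //; lra.
  - by rewrite affine_path_rev_image gB.
have {}w01 : 0 < w < 1 by rewrite !lt_neqAle eq_sym w0 w1.
exfalso.
(* The first leg of the triod starts at [w / 2] and not at 0, so that the triod misses [g 0] and its
   union is proper, as [atriodic] requires. *)
have h2 : 0 < w / 2 by lra.
have sP : subcontinuum (g @` `[w / 2, w]%classic) by apply: path_image_subcontinuum => //; lra.
have sQ : subcontinuum (g @` `[w, 1]%classic) by apply: path_image_subcontinuum => //; lra.
have sC : subcontinuum (F @` `[0, 1]%classic) by apply: path_image_subcontinuum.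
have notin s l r : 0 <= s <= 1 -> 0 <= l -> r <= 1 -> s < l \/ r < s ->
    ~ (g @` `[l, r]%classic) (g s).
  move=> s01 l0 r1 slr [t]; rewrite /= in_itv /= => /andP[lt tr] /Ig ts.
  have {}ts : t = s by apply: ts; lra.
  by case: slr; rewrite -ts ltNge ?lt ?tr.
have notF s : 0 <= s <= 1 -> s < w \/ w < s -> ~ (F @` `[0, 1]%classic) (g s).
  move=> s01 sw [t]; rewrite /= in_itv /= => t01 /esym/gFw[]// sE _.
  by case: sw; rewrite sE ltxx.
have [||||h|h|h] := @atriodic _ _ aX _ _ _ (f y) sP sQ sC.
- by exists w => //; rewrite /= in_itv /=; lra.
- by exists w => //; rewrite /= in_itv /=; lra.
- by exists 0 => //; apply: in01; rewrite lexx ler01.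
- move=> PT; have : (g @` `[w / 2, w]%classic `|` g @` `[w, 1]%classic
    `|` F @` `[0, 1]%classic) (g 0) by rewrite PT.
  by move=> [[]|]; [apply: notin|apply: notin|apply: notF]; (try by left; lra); lra.
- have : (g @` `[w / 2, w]%classic) (g (w / 2)).
    by exists (w / 2) => //; rewrite /= in_itv /=; lra.
  by move=> /h[]; [apply: notin|apply: notF]; (try by left; lra); lra.
- have : (g @` `[w, 1]%classic) (g 1).
    by exists 1 => //; rewrite /= in_itv /=; lra.
  by move=> /h[]; [apply: notin|apply: notF]; (try by right; lra); lra.
- have : (F @` `[0, 1]%classic) (F 1) by exists 1 => //; apply: in01; lra.
  have nF1 : ~ B1 (F 1).
    move=> /FB1 F1; have /eqP : (1 : R) = 0 by apply: F1; lra.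
    by rewrite oner_eq0.
  have gB1 l r : 0 <= l -> r <= 1 -> g @` `[l, r]%classic `<=` B1.
    move=> l0 r1 _ [t + <-]; rewrite /= in_itv /= -gB => tlr; exists t => //.
    by apply: in01; lra.
  by move=> /h[] /gB1 F1; apply: nF1; apply: F1; lra.
Qed.

(** The arc [A] either has an end outside [B], and [X] is an arc, or has both ends in [B], and [X]
    is a circle; in the latter case [A] still leaves [B], since [B] is proper. *)
Lemma decomposable_ray A B : subcontinuum A -> subcontinuum B ->
  A <> [set: X] -> B <> [set: X] -> A `|` B = [set: X] ->
  exists phi : R -> X, lifting_ray phi.
Proof.
move=> sA sB AT BT AB.
have AB0 := cover_meets sA sB AB.
have nd C D : C `|` D = [set: X] -> D <> [set: X] -> C `&` D !=set0 ->
    exists x y, [/\ C x, C y & x <> y].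
  move=> CD DT [x [Cx Dx]]; have /existsNP[y Dy] : ~ forall y, D y.
    by move=> h; apply: DT; apply/seteqP; split.
  exists x, y; split=> //; last by move=> xy; rewrite xy in Dx.
  have : (C `|` D) y by rewrite CD.
  by case.
have And := nd A B AB BT AB0.
have Bnd : exists x y, [/\ B x, B y & x <> y] by apply: (nd B A) => //; [rewrite setUC|rewrite setIC].
have [f [cf fA _ /(_ And) If]] := proper_subcontinuum_path aX sA AT.
have [g [cg gB _ /(_ Bnd) Ig]] := proper_subcontinuum_path aX sB BT.
have [B1|B1] := pselect (B (f 1)); last exact: (arc_case sB Bnd AB0 AB fA cf If).
have [B0|B0] := pselect (B (f 0)); last first.
  apply: (arc_case (f := affine_path f 1 0) sB Bnd AB0 AB).
  - by rewrite affine_path_rev_image.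
  - exact: affine_path_continuous.
  - by apply: (affine_path_inj _ _ _ If); rewrite ?oner_neq0//; lra.
  - by rewrite affine_path1.
have /existsNP[t /not_implyP[t01 nBt]] : ~ forall t, 0 <= t <= 1 -> B (f t).
  move=> h; apply: BT; rewrite -AB; apply/esym/setUidPr => x.
  by rewrite -fA => -[t]; rewrite /= in_itv /= => /h ? <-.
exact: (circle_case sB cf cg If Ig gB B0 B1 t01 nBt).
Qed.

End decomposable.

(** * Indecomposable arc continua *)

Section chains.
Context {R : realType} {X : metricType R}.
Hypothesis cX : compact [set: X].
Implicit Types (V A B C : set X) (e : R).

Lemma compact_disjoint_gap A B : closed A -> closed B -> A `&` B = set0 ->
  exists2 e, 0 < e & forall x y, A x -> B y -> e <= mdist x y.
Proof.
move=> cA cB AB.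
have kA : compact A by exact: subclosed_compact cX _.
have : \forall e \near (0 : R)^'+, forall x, A x -> forall y, B y -> e <= mdist x y.
  move/compact_near_coveringP: kA; apply => x Ax.
  have : nbhs x (~` B).
    apply: open_nbhs_nbhs; split; first exact: closed_openC.
    by move=> Bx; have : (A `&` B) x by []; rewrite AB.
  rewrite -nbhs_ballE => -[r /= r0 rB].
  have r2 : 0 < r / 2 by lra.
  exists (ball x (r / 2), [set e | e < r / 2]).
    split=> /=; first exact: nbhsx_ballx.
    exact: nbhs_right_lt.
  move=> [y e] /= [/ball_mdist xy er] z Bz.
  rewrite leNgt; apply/negP => yz; apply: (rB z) => //; apply/ball_mdist.
  by have := metric_triangle x y z; lra.
move=> h; near (0 : R)^'+ => e; exists e => //.
by move=> x y Ax By; move: x Ax y By; near: e.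
Unshelve. all: by end_near. Qed.

Variables (V : set X) (p : X).
Hypotheses (cV : closed V) (Vp : V p).

(* The points of V reached from p by steps in V of length less than e, stated
   impredicatively instead of with finite chains. *)
Definition chained e : set X := [set z | forall S : set X, S p ->
  (forall y y', S y -> V y' -> mdist y y' < e -> S y') -> S z].

Lemma chained_refl e : chained e p. Proof. by move=> S. Qed.

Lemma chained_step e y z : chained e y -> V z -> mdist y z < e -> chained e z.
Proof. by move=> ey Vz yz S Sp Sc; apply: (Sc y) => //; exact: ey. Qed.

Lemma chained_sub e : chained e `<=` V.
Proof. by move=> z; apply. Qed.

Lemma chained_le e1 e2 : e1 <= e2 -> chained e1 `<=` chained e2.
Proof.
move=> e12 z ez S Sp Sc; apply: ez => // y y' Sy Vy' yy'.
by apply: (Sc y) => //; exact: lt_le_trans e12.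
Qed.

Lemma chained_closed e : 0 < e -> closed (chained e).
Proof.
move=> e0 z cz; have Vz : V z.
  by rewrite ((closure_id _).1 cV); apply: closureS cz; exact: chained_sub.
have [y [ey /ball_mdist zy]] := cz _ (nbhsx_ballx z e e0).
by apply: (chained_step ey) => //; rewrite metric_sym.
Qed.

(** For compact [V] this is the component of [p] in [V], obtained from chains so that every
    approximation [chained e] can be handled separately. *)
Definition quasi_component : set X := \bigcap_(e in [set e : R | 0 < e]) chained e.

Lemma quasi_component_closed : closed quasi_component.
Proof. by apply: closed_bigI => e e0; exact: chained_closed. Qed.

(** A point [x] of [C] is unreachable with steps below some [e0]; then no shorter chain reaches a
    point within [e0] of [x], as one more step would lead to [x]. Compactness of [C] makes the bound
    uniform. *)
Lemma quasi_component_avoid C : closed C -> C `<=` V ->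
  quasi_component `&` C = set0 ->
  exists2 e0, 0 < e0 & forall e, 0 < e -> e < e0 -> chained e `&` C = set0.
Proof.
move=> cC CV QC; have kC : compact C by exact: subclosed_compact cX _.
have : \forall e \near (0 : R)^'+, forall x, C x -> ~ chained e x.
  move/compact_near_coveringP: kC; apply => x Cx.
  have /existsNP[e0 /not_implyP[e00 nx]] : ~ quasi_component x.
    by move=> Qx; have : (quasi_component `&` C) x by []; rewrite QC.
  exists (ball x e0, [set e | e < e0]).
    by split; [exact: nbhsx_ballx|exact: nbhs_right_lt].
  move=> [y e] /= [/ball_mdist xy ee0] ey; apply: nx.
  apply: (@chained_step _ y); [exact: chained_le (ltW ee0) _ ey|exact: CV|].
  by rewrite metric_sym.
move=> [e0 /= e00 he]; exists e0 => // e e1 e2; apply/seteqP; split=> // x [ex Cx].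
apply: (he e) ex => //=; first by rewrite sub0r normrN gtr0_norm.
Qed.

(** Two separated parts would have a positive distance [d]. Short chains avoid the points of [V] at
    distance [d / 3] or more from both parts, and steps of length at most [d / 3] cannot jump
    across, so chains from [p] would never come near the other part. *)
Lemma quasi_component_connected : connected quasi_component.
Proof.
apply/connectedP => E [E0 QE [sE1 sE2]].
have cE b : closed (E b).
  move=> x cx; have Qx : quasi_component x.
    rewrite ((closure_id _).1 quasi_component_closed); apply: closureS cx.
    by rewrite QE; case: b => y; [right|left].
  move: Qx; rewrite QE; case: b cx => cx [] // Ex.
    by have : (E false `&` closure (E true)) x by []; rewrite sE2.
  by have : (closure (E false) `&` E true) x by []; rewrite sE1.
have [b Eb] : exists b, E b p.
  have : quasi_component p by move=> e _; exact: chained_refl.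
  by rewrite QE => -[]; [exists false|exists true].
have dE : E b `&` E (~~ b) = set0.
  have d0 : E false `&` E true = set0 by exact: separated_disjoint.
  by case: (b) => //; rewrite setIC.
have QEb x : quasi_component x -> E b x \/ E (~~ b) x.
  by rewrite QE; case: (b) => -[]; auto.
have [d d0 gap] := compact_disjoint_gap (cE b) (cE (~~ b)) dE.
have d3 : 0 < d / 3 by lra.
pose C := V `\` (set_nbhd (d / 3) (E b) `|` set_nbhd (d / 3) (E (~~ b))).
have cC : closed C.
  apply: closedI => //; apply: open_closedC; apply: openU; exact: set_nbhd_open.
have [||e0 e00 he] := quasi_component_avoid cC _ _.
- by move=> x [].
- apply/seteqP; split=> // x [Qx [_]]; apply.
  by have [Ex|Ex] := QEb x Qx; [left|right]; exact: sub_set_nbhd.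
pose e := Num.min (e0 / 2) (d / 3).
have [e1 e2 e3] : [/\ 0 < e, e < e0 & e <= d / 3].
  by rewrite /e lt_min gt_min ge_min lexx orbT; split=> //; lra.
have eC := he e e1 e2.
have eb : chained e `<=` set_nbhd (d / 3) (E b).
  (* The set fed to the definition of [chained] keeps chain membership as part of the invariant,
     which is needed to know that the next point avoids [C]. *)
  move=> z ez; have [] : (chained e `&` set_nbhd (d / 3) (E b)) z; last by [].
  apply: ez; first by split; [exact: chained_refl|exact: sub_set_nbhd].
  move=> y y' [ey [a Ea /ball_mdist ay]] Vy' yy'.
  have ey' : chained e y' by exact: chained_step ey Vy' yy'.
  split=> //; apply: contrapT => nb.
  have [|[c Ec /ball_mdist cy]] : (set_nbhd (d / 3) (E b) `|` set_nbhd (d / 3) (E (~~ b))) y'.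
    apply: contrapT => nn; have : (chained e `&` C) y' by [].
    by rewrite eC.
    exact: nb.
  have := gap a c Ea Ec; have := metric_triangle a y c; have := metric_triangle y y' c.
  by rewrite (metric_sym y' c); lra.
have [c Ec] := E0 (~~ b).
have Qc : quasi_component c by rewrite QE; move: Ec; case: (b); [left|right].
have [a Ea /ball_mdist ac] := eb c (Qc e e1).
by have := gap a c Ea Ec; lra.
Qed.

End chains.

(** * Boundary bumping and density of composants *)

Section composant.
Context {R : realType} {X : metricType R}.
Hypothesis cX : compact [set: X].
Hypothesis kX : connected [set: X].
Hypothesis X2 : exists x y : X, x <> y.

(** Boundary bumping: the component of [p] in the complement of the ball of radius [r = e / 3]
    around [x] must come within [2 * r < e] of [x]. *)
Lemma composant_dense (p x : X) (e : R) : 0 < e -> exists D : set X,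
  [/\ subcontinuum D, D p, D <> [set: X] & exists2 y, D y & mdist x y < e].
Proof.
move=> e0; pose r := e / 3; have r0 : 0 < r by rewrite /r; lra.
have [pr|rp] := ltP (mdist x p) r.
  exists [set p]; split=> //.
  - split; [by exists p|exact: compact_set1|exact: connected1].
  - move=> pT; have [y [z yz]] := X2; apply: yz.
    have [] : [set p] y /\ [set p] z by rewrite pT.
    by move=> -> ->.
  - by exists p => //; move: pr; rewrite /r; lra.
pose V := [set y | r <= mdist x y].
have cV : closed V.
  rewrite (_ : V = (fun y => mdist x y) @^-1` `[r, +oo[%classic); last first.
    by apply/seteqP; split=> y; rewrite /V /= in_itv /= andbT.
  by apply: preimage_closed; [move=> ? _; exact: mdist_continuous|exact: rray_closed].
pose Q := quasi_component V p.
have cQ : closed Q by exact: quasi_component_closed.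
have QV : Q `<=` V by move=> y Qy; exact: (chained_sub rp (Qy 1 ltr01)).
exists Q; split.
- apply/(subcontinuumP _ cX); split=> //; first by exists p => d _; exact: chained_refl.
  exact: quasi_component_connected.
- by move=> d _; exact: chained_refl.
- move=> QT; have /QV : Q x by rewrite QT.
  by rewrite /V /= mdistxx leNgt r0.
- apply: contrapT => far.
  pose C := V `&` [set y | mdist x y <= 2 * r].
  have cC : closed C.
    apply: closedI => //.
    rewrite (_ : mkset _ = (fun y => mdist x y) @^-1` `]-oo, 2 * r]%classic); last first.
      by apply/seteqP; split=> y; rewrite /= in_itv.
    by apply: preimage_closed; [move=> ? _; exact: mdist_continuous|exact: lray_closed].
  have [||d d0 hd] := quasi_component_avoid cX (V := V) (p := p) cC.
  + by move=> y [].
  + apply/seteqP; split=> // y [Qy [_ /= yr]]; apply: far; exists y => //.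
    by move: yr; rewrite /r; lra.
  pose c := Num.min (d / 2) r.
  have [c0 cd cr] : [/\ 0 < c, c < d & c <= r].
    by rewrite /c lt_min gt_min ge_min lexx orbT; split=> //; lra.
  have hc := hd c c0 cd.
  (* The chains avoid the shell of distances from [r] to [2 * r], so a reached point is farther than
     [2 * r] from [x] and its ball of radius [c <= r] stays in [V]. The reached set is thus open as
     well as closed in the connected space [X]. *)
  have QT : chained V p c = [set: X].
    apply: kX; first by exists p; exact: chained_refl.
      exists (chained V p c); last by rewrite setTI.
      rewrite openE => y cy; rewrite /interior -nbhs_ballE; exists c => //= z /ball_mdist yz.
      apply: (chained_step cy) => //.
      have y2 : 2 * r < mdist x y.
        rewrite ltNge; apply/negP => yr.
        have : (chained V p c `&` C) y by split=> //; split=> //; exact: (chained_sub rp cy).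
        by rewrite hc.
      by rewrite /V /=; have := metric_triangle x z y; rewrite (metric_sym z y); lra.
    exists (chained V p c); last by rewrite setTI.
    exact: chained_closed.
  have /(chained_sub rp) : chained V p c x by rewrite QT.
  by rewrite /V /= mdistxx leNgt r0.
Qed.

End composant.

Lemma compact_metric_second_countable (R : realType) (X : metricType R) (p : X) :
  compact [set: X] -> @second_countable X.
Proof.
move=> cX.
pose X' : pseudoPMetricType R := HB.pack (X : Type) (isPointed.Build X p) (PseudoMetric.on X).
exact: (@compact_second_countable R X' cX).
Qed.

(** * Exhausting a composant by a sequence *)

Section composant_sequence.
Context {R : realType} {X : metricType R}.
Hypothesis cX : compact [set: X].
Hypothesis X2 : exists x y : X, x <> y.
Variable p : X.

Lemma subcontinuum1 : subcontinuum [set p].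
Proof. by split; [exists p|exact: compact_set1|exact: connected1]. Qed.

Lemma set1_proper : [set p] <> [set: X].
Proof.
move=> pT; have [y [z yz]] := X2; apply: yz.
have [-> ->] : [set p] y /\ [set p] z by rewrite pT.
by [].
Qed.

(** For each nonempty basic open set missing [p], take the component of [p] in its complement. A
    proper subcontinuum through [p] misses a basic neighbourhood of some point, so it lies in one of
    these components. Indices that code no such open set get [[set p]]. *)
Lemma composant_countable : exists D : nat -> set X,
  (forall n, [/\ subcontinuum (D n), D n p & D n <> [set: X]]) /\
  forall A, subcontinuum A -> A p -> A <> [set: X] -> exists n, A `<=` D n.
Proof.
have [B cB [oB bB]] := compact_metric_second_countable p cX.
have /countable_injP[f If] := cB.
pose code n (U : set X) := [/\ B U, f U = n, U !=set0 & ~ U p].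
pose D n := if pselect (exists U, code n U) is left h
  then connected_component (~` (projT1 (cid h))) p else [set p].
exists D; split=> [n|A sA Ap AT].
  rewrite /D; case: pselect => [h|_]; last first.
    by split=> //; [exact: subcontinuum1|exact: set1_proper].
  case: (cid h) => U [BU _ [x Ux] Up] /=.
  have cp : connected_component (~` U) p p by exact: connected_component_refl.
  split=> //.
    apply/(subcontinuumP _ cX); split; [by exists p| |exact: component_connected].
    by apply: component_closed; apply: open_closedC; exact: oB.
  move=> CT; have : connected_component (~` U) p x by rewrite CT.
  by move=> /(@connected_component_sub _ (~` U)).
have [_ cA kA] := sA.
have [x Ax] : exists x, ~ A x.
  by apply/existsNP => h; apply: AT; apply/seteqP; split.
have nA : nbhs x (~` A).
  apply: open_nbhs_nbhs; split => //; apply: closed_openC.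
  exact: compact_metric_closed.
have [U [BU Ux] UA] := bB x _ nA.
have cU : code (f U) U by split=> //; [exists x|move=> /UA].
exists (f U); rewrite /D; case: pselect => [h|[]]; last by exists U.
case: (cid h) => W [BW WU _ _] /=.
have -> : W = U by apply: If => //; rewrite inE.
by apply: connected_component_max => //; move=> y Ay Uy; exact: (UA y).
Qed.

(** The sequence is made increasing by finite unions, which remain proper because [X] is
    indecomposable. *)
Lemma composant_chain :
  (forall A B : set X, subcontinuum A -> subcontinuum B -> A <> [set: X] ->
    B <> [set: X] -> A `|` B <> [set: X]) ->
  exists D : nat -> set X, [/\ D 0%N = [set p],
    forall n, [/\ subcontinuum (D n), D n p & D n <> [set: X]],
    forall n, D n `<=` D n.+1 &
    forall A, subcontinuum A -> A p -> A <> [set: X] -> exists n, A `<=` D n].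
Proof.
move=> indec; have [D [HD cofD]] := composant_countable.
pose E := fix E n := if n is m.+1 then E m `|` D m else [set p].
exists E; split=> //.
- elim=> [|n [sE Ep ET]] /=.
    by split=> //; [exact: subcontinuum1|exact: set1_proper].
  have [sD Dp DT] := HD n; split; [|by left|exact: indec].
  by apply: subcontinuumU => //; exists p.
- by move=> n x Ex; left.
- move=> A sA Ap AT; have [n An] := cofD A sA Ap AT.
  by exists n.+1 => x /An; right.
Qed.

End composant_sequence.

(** * Extending a path inside a larger arc *)

Section line_extension.
Context {R : realType} {X : metricType R}.
Implicit Types (f g h : R -> X) (A : set X).

Definition convex_fibers f (l r : R) := forall A, convex_fibers_over A f l r.

Lemma convex_fibersP f l r : convex_fibers f l r <->
  forall s t u, l <= s -> s <= t -> t <= u -> u <= r -> f s = f u -> f t = f s.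
Proof.
split=> [Cf s t u ls st tu ur su|Cf A s t u ls st tu ur su _].
  by apply: (Cf setT s t u).
exact: (Cf s t u).
Qed.

Lemma convex_fibers_comp f (m : R -> R) (l r l' r' : R) :
  convex_fibers f l' r' -> (forall s t, l <= s -> s <= t -> t <= r -> m s <= m t) ->
  l' <= m l -> m r <= r' -> convex_fibers (f \o m) l r.
Proof.
move=> /convex_fibersP Cf mono ml mr; apply/convex_fibersP => s t u ls st tu ur su.
have sr : s <= r by lra.
have lu : l <= u by lra.
apply: (Cf _ _ (m u)) => //.
- exact/(le_trans ml)/mono.
- by apply: mono => //; lra.
- by apply: mono => //; lra.
- by apply: le_trans mr; exact: mono.
Qed.

Lemma glue_convex_fibers f g (l m r : R) : l <= m -> m <= r ->
  convex_fibers f l m -> convex_fibers g m r ->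
  (forall s t, l <= s <= m -> m <= t <= r -> f s = g t -> f s = f m) ->
  f m = g m ->
  convex_fibers (fun t => if t <= m then f t else g t) l r.
Proof.
move=> lm mr /convex_fibersP Cf /convex_fibersP Cg fg fgm.
apply/convex_fibersP => s t u ls st tu ur /=.
have [um|mu] := leP u m.
  by rewrite !ifT; [exact: Cf|lra..].
have [sm|ms] := leP s m; last first.
  by rewrite ifF; [move=> su; apply: (Cg s t u) => //; lra|apply/negbTE; rewrite -ltNge; lra].
move=> su; have sm' : f s = f m by apply: (fg s u) => //; lra.
case: ifPn => tm; first exact: (Cf s t m).
rewrite -ltNge in tm; rewrite sm' fgm; apply: (Cg m t u) => //; first exact: ltW.
by rewrite -fgm -sm'.
Qed.

(** The parameters not mapped to [x] form an interval: a return to the value of an end would force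
    that value all the way to that end. The lemma serves to recognize ends of an arc by
    connectedness. *)
Lemma connected_minus_end f (l r : R) x : continuous f -> convex_fibers f l r ->
  x = f l \/ x = f r -> connected (f @` `[l, r]%classic `\` [set x]).
Proof.
move=> cf /convex_fibersP Cf xlr.
pose J := [set t | l <= t <= r /\ f t <> x].
have -> : f @` `[l, r]%classic `\` [set x] = f @` J.
  apply/seteqP; split=> [_ [[t + <-] tx]|_ [t [tlr tx] <-]].
    by rewrite /= in_itv /= => tlr; exists t.
  by split=> //; exists t => //=; rewrite in_itv.
apply: connected_continuous_connected; last exact: continuous_subspaceT.
apply/connected_intervalP => s u [slr sx] [ulr ux] t /andP[st tu]; split; first by lra.
case: xlr => xE tx.
  have tr : t <= r by lra.
  have : f s = f l by apply: (Cf l s t) => //; [case/andP: slr|rewrite tx].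
  by rewrite -xE => /sx.
have lt : l <= t by lra.
by apply: ux; rewrite -tx; apply: (Cf t u r) => //; [case/andP: ulr|rewrite tx].
Qed.

(** The preimage of the smaller path under [h] is an interval [[u, v]]. Removing an end value of [g]
    leaves the image of [g] connected, whereas removing a value of [h] in between, other than [h u]
    and [h v], would disconnect it; so ends correspond to ends, in one of two orders. *)
Lemma arc_position g h (l r : R) : continuous g -> continuous h ->
  convex_fibers g l r -> convex_fibers h 0 1 -> l <= r ->
  g @` `[l, r]%classic `<=` h @` `[0, 1]%classic ->
  exists u v, [/\ 0 <= u, u <= v, v <= 1,
    (forall t, 0 <= t <= 1 -> (g @` `[l, r]%classic) (h t) <-> u <= t <= v) &
    (h u = g l /\ h v = g r) \/ (h u = g r /\ h v = g l)].
Proof.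
move=> cg ch Cg Ch lr gh; have Cg' := (convex_fibersP _ _ _).1 Cg.
pose K := g @` `[l, r]%classic; pose J := `[0, 1]%classic `&` h @^-1` K.
have glK t : l <= t <= r -> K (g t) by move=> tlr; exists t; rewrite //= in_itv.
have cJ : compact J.
  apply: compact_closedI; first exact: segment_compact.
  by apply: preimage_closed => //; exact: path_image_closed.
have J0 : J !=set0.
  have [t t01 tl] : (h @` `[0, 1]%classic) (g l) by apply/gh/glK; lra.
  by exists t; split=> //; rewrite /= tl; apply: glK; lra.
have cid : {within J, continuous (fun t : R => t)}.
  by apply: continuous_subspaceT => t; exact: cvg_id.
have [u /set_mem[+ Ku] umin] := compact_EVT_min J0 cJ cid.
have [v /set_mem[+ Kv] vmax] := compact_EVT_max J0 cJ cid.
rewrite /= !in_itv /= => /andP[v0 v1] /andP[u0 u1].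
have uv : u <= v by apply: umin; rewrite inE; split; rewrite //= in_itv /= v0.
have kK : connected K by exact: path_image_connected.
have huv t : 0 <= t <= 1 -> K (h t) <-> u <= t <= v.
  move=> t01; split=> [Kt|/andP[ut tv]].
    have tJ : t \in J by rewrite inE; split; rewrite //= in_itv.
    by rewrite umin// vmax.
  exact: (convex_preimage ch kK gh (Ch K) u0 ut tv v1).
have ends x : x = g l \/ x = g r -> K x -> x = h u \/ x = h v.
  move=> xlr Kx; apply: contrapT => /not_orP[xu xv].
  have [w] := gh x Kx; rewrite /= in_itv /= => w01 wx.
  have /(huv w w01) /andP[uw wv] : K (h w) by rewrite wx.
  have kKx := connected_minus_end cg Cg xlr.
  have [_] : (K `\` [set x]) (h w); last by apply.
  apply: (convex_preimage ch kKx _ (Ch _) u0 uw wv v1).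
  - by move=> y [/gh].
  - by split=> // /esym.
  - by split=> // /esym.
exists u, v; split=> //.
have gl : K (g l) by apply: glK; lra.
have gr : K (g r) by apply: glK; lra.
have [lrE|lrn] := pselect (g l = g r).
  have const x : K x -> x = g l.
    move=> [t + <-]; rewrite /= in_itv /= => /andP[lt tr].
    exact: (Cg' l t r).
  by left; rewrite -lrE (const _ Ku) (const _ Kv).
have [lu|lv] := ends (g l) (or_introl erefl) gl;
  have [ru|rv] := ends (g r) (or_intror erefl) gr.
- by case: lrn; rewrite lu ru.
- by left.
- by right.
- by case: lrn; rewrite lv rv.
Qed.

End line_extension.

Section path_extension.
Context {R : realType} {X : metricType R}.
Implicit Types (f g h : R -> X).

Lemma convex_fibers_rev h : convex_fibers h 0 1 ->
  convex_fibers (affine_path h 1 0) 0 1.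
Proof.
move=> /convex_fibersP Ch; apply/convex_fibersP => s t u s0 st tu u1 su.
rewrite su; rewrite /affine_path in su *.
by apply: (Ch (1 + u * (0 - 1)) _ (1 + s * (0 - 1))); rewrite ?su//; lra.
Qed.

(** [g] is left unchanged on [[l, r]], so that successive extensions fit together into one map of
    the line; the missing parts of the larger arc are run through in the two added unit
    intervals. *)
Lemma extend_oriented g h (l r u v : R) : continuous g -> continuous h ->
  convex_fibers g l r -> convex_fibers h 0 1 -> l <= r ->
  0 <= u -> u <= v -> v <= 1 -> h u = g l -> h v = g r ->
  (forall t, 0 <= t <= 1 -> (g @` `[l, r]%classic) (h t) <-> u <= t <= v) ->
  g @` `[l, r]%classic `<=` h @` `[0, 1]%classic ->
  exists g', [/\ continuous g', convex_fibers g' (l - 1) (r + 1),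
    g' @` `[l - 1, r + 1]%classic = h @` `[0, 1]%classic &
    forall t, l <= t <= r -> g' t = g t].
Proof.
move=> cg ch Cg Ch lr u0 uv v1 hu hv huv gh.
(* [mL] carries [[l - 1, l]] linearly to [[0, u]], and [mR] carries [[r, r + 1]] to [[v, 1]]. For
   [u = 0] or [v = 1] the path waits at that end, so injectivity would be too much to ask. *)
pose mL t := (t - (l - 1)) * u; pose mR t := v + (t - r) * (1 - v).
have cL : continuous (h \o mL).
  move=> t; apply: continuous_comp; last exact: ch.
  apply: continuousM; last exact: cst_continuous.
  by apply: continuousB; [exact: cvg_id|exact: cst_continuous].
have cR : continuous (h \o mR).
  move=> t; apply: continuous_comp; last exact: ch.
  apply: continuousD; first exact: cst_continuous.
  apply: continuousM; last exact: cst_continuous.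
  by apply: continuousB; [exact: cvg_id|exact: cst_continuous].
have mL0 : mL (l - 1) = 0 by rewrite /mL subrr mul0r.
have mL1 : mL l = u by rewrite /mL; lra.
have mR0 : mR r = v by rewrite /mR subrr mul0r addr0.
have mR1 : mR (r + 1) = 1 by rewrite /mR; lra.
have mLm s t : s <= t -> mL s <= mL t by move=> st; rewrite ler_wpM2r// lerB.
have mRm s t : s <= t -> mR s <= mR t.
  by move=> st; rewrite lerD2l ler_wpM2r ?subr_ge0// lerB.
have CL : convex_fibers (h \o mL) (l - 1) l.
  by apply: (convex_fibers_comp Ch); rewrite ?mL0 ?mL1//; [move=> *; exact: mLm|lra].
have CR : convex_fibers (h \o mR) r (r + 1).
  by apply: (convex_fibers_comp Ch); rewrite ?mR0 ?mR1//; [move=> *; exact: mRm|lra].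
pose g1 t := if t <= l then (h \o mL) t else g t.
pose g2 t := if t <= r then g1 t else (h \o mR) t.
have Lu t : l - 1 <= t <= l -> 0 <= mL t <= u.
  by move=> /andP[t1 t2]; rewrite -{1}mL0 -mL1 !mLm.
have Rv t : r <= t <= r + 1 -> v <= mR t <= 1.
  by move=> /andP[t1 t2]; rewrite -{1}mR0 -mR1 !mRm.
have gK t : l <= t <= r -> (g @` `[l, r]%classic) (g t).
  by move=> tlr; exists t; rewrite //= in_itv.
have hL : (h \o mL) l = g l by rewrite /= mL1.
have cg1 : continuous g1 by exact: glue_continuous.
have g1r : g1 r = (h \o mR) r.
  rewrite /g1 /= mR0 hv; case: ifPn => // rl.
  have -> : r = l by lra.
  by rewrite mL1.
have cg2 : continuous g2 by exact: glue_continuous.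
have Cg1 : convex_fibers g1 (l - 1) r.
  apply: glue_convex_fibers => //; first by lra.
  move=> s t sl tr st.
  have us := Lu s sl; have us1 : 0 <= mL s <= 1 by lra.
  have /(huv _ us1) us' : (g @` `[l, r]%classic) (h (mL s)).
    by have := gK t tr; rewrite -st.
  by rewrite /= mL1; congr h; lra.
exists g2; split=> //.
- apply: glue_convex_fibers => //; [by lra|by lra|].
  move=> s t sr tr st; have vt := Rv t tr.
  rewrite g1r /= mR0; move: st; rewrite {1}/g1; case: ifPn => sl.
    have sl' : l - 1 <= s <= l by lra.
    have us := Lu s sl'; rewrite /= => st.
    have g1s : g1 s = h (mL s) by rewrite /g1 sl.
    rewrite g1s; have /convex_fibersP Ch' := Ch.
    by symmetry; apply: (Ch' (mL s) v (mR t)) => //; lra.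
  rewrite -ltNge in sl; move=> /= st; have slr : l <= s <= r by lra.
  have t1 : 0 <= mR t <= 1 by lra.
  have /(huv _ t1) ut : (g @` `[l, r]%classic) (h (mR t)).
    by have := gK s slr; rewrite st.
  by rewrite /g1 ifF ?st; [congr h; lra|apply/negbTE; rewrite -ltNge].
- apply/seteqP; split=> [_ [t + <-]|_ [y + <-]]; rewrite /= in_itv /= => t01.
    rewrite /g2 /g1; case: ifPn => tr; last first.
      rewrite -ltNge in tr; have tr' : r <= t <= r + 1 by lra.
      by have := Rv t tr'; exists (mR t) => //=; rewrite in_itv /=; lra.
    case: ifPn => tl.
      have tl' : l - 1 <= t <= l by lra.
      by have := Lu t tl'; exists (mL t) => //=; rewrite in_itv /=; lra.
    by rewrite -ltNge in tl; apply/gh/gK; lra.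
  have [yu|uy] := ltP y u.
    exists (l - 1 + y / u).
      have : 0 <= y / u <= 1 by rewrite divr_ge0 ?ler_pdivrMr; lra.
      by rewrite /= in_itv /=; lra.
    have h1 : 0 <= y / u <= 1 by rewrite divr_ge0 ?ler_pdivrMr; lra.
    have tl : l - 1 + y / u <= l by lra.
    have u0' : u != 0 by rewrite gt_eqF//; lra.
    rewrite /g2 /g1 (le_trans tl lr) tl /= /mL.
    by congr h; rewrite addrC addKr divfK.
  have [yv|vy] := leP y v.
    have [t] : (g @` `[l, r]%classic) (h y) by apply/huv; lra.
    rewrite /= in_itv /= => /andP[lt tr] ty; exists t; first by rewrite /= in_itv /=; lra.
    rewrite /g2 /g1 tr; case: ifPn => // tl.
    have tE : t = l by lra.
    by rewrite tE /= mL1 hu -tE.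
  exists (r + (y - v) / (1 - v)).
    have : 0 <= (y - v) / (1 - v) <= 1 by rewrite divr_ge0 ?ler_pdivrMr; lra.
    by rewrite /= in_itv /=; lra.
  have h1 : 0 < (y - v) / (1 - v) by rewrite divr_gt0; lra.
  rewrite /g2 ifF /= /mR; last by apply/negbTE; rewrite -ltNge; lra.
  by congr h; rewrite addrAC subrr add0r divfK; [lra|rewrite gt_eqF//; lra].
- move=> t /andP[lt tr]; rewrite /g2 /g1 tr; case: ifPn => // tl.
  have tE : t = l by lra.
  by rewrite tE /= mL1.
Qed.

Lemma extend_path g (l r : R) D : arc_continuum X -> continuous g ->
  convex_fibers g l r -> l <= r -> subcontinuum D -> D <> [set: X] ->
  g @` `[l, r]%classic `<=` D ->
  exists g', [/\ continuous g', convex_fibers g' (l - 1) (r + 1),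
    g' @` `[l - 1, r + 1]%classic = D &
    forall t, l <= t <= r -> g' t = g t].
Proof.
move=> aX cg Cg lr sD DT gD.
have [h [ch hD Ch _]] := proper_subcontinuum_path aX sD DT.
rewrite -hD in gD *.
have [u [v [u0 uv v1 huv [[hu hv]|[hu hv]]]]] := arc_position cg ch Cg Ch lr gD.
  exact: (extend_oriented cg ch Cg Ch lr u0 uv v1).
(* Here [g] runs against [h]; reversing [h] turns [[u, v]] into [[1 - v, 1 - u]] and restores the
   orientation. *)
rewrite -affine_path_rev_image in gD *.
have revE t : affine_path h 1 0 t = h (1 - t) by rewrite /affine_path; congr h; lra.
apply: (extend_oriented (h := affine_path h 1 0) (u := 1 - v) (v := 1 - u)) => //.
- exact: affine_path_continuous.
- exact: convex_fibers_rev.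
- by lra.
- by lra.
- by lra.
- by rewrite revE (_ : 1 - (1 - v) = v)//; lra.
- by rewrite revE (_ : 1 - (1 - u) = u)//; lra.
- move=> t t01; rewrite revE huv; last by lra.
  by split=> ?; lra.
Qed.

End path_extension.

Section composant_line.
Context {R : realType} {X : metricType R}.
Hypothesis aX : arc_continuum X.

Lemma composant_line (D : nat -> set X) (p : X) : D 0%N = [set p] ->
  (forall n, [/\ subcontinuum (D n), D n p & D n <> [set: X]]) ->
  (forall n, D n `<=` D n.+1) ->
  exists psi : R -> X, [/\ continuous psi,
    forall n, psi @` `[- n%:R, n%:R]%classic = D n &
    forall n, convex_fibers psi (- n%:R) n%:R].
Proof.
move=> D0 HD DS.
pose good n (g : R -> X) := [/\ continuous g, convex_fibers g (- n%:R) n%:R &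
  g @` `[- n%:R, n%:R]%classic = D n].
(* Only good pairs can be extended, while [choice] asks for a total relation; hence goodness is a
   premise inside the existential. *)
have step (ng : nat * (R -> X)) : exists g', good ng.1 ng.2 ->
    good ng.1.+1 g' /\ forall t, - ng.1%:R <= t <= ng.1%:R -> g' t = ng.2 t.
  case: ng => n g /=; have [[cg Cg gD]|] := pselect (good n g); last by exists g.
  have [sD _ DT] := HD n.+1.
  have nn : - n%:R <= n%:R :> R by have := ler0n R n; lra.
  have [|g' [cg' Cg' g'D agree]] := extend_path aX cg Cg nn sD DT.
    by rewrite gD.
  exists g' => _; split=> //; split=> //.
    by rewrite -natr1 opprD.
  by rewrite -natr1 opprD.
have [F HF] := choice step.
pose G := fix G n := if n is m.+1 then F (m, G m) else (fun=> p).
have goodG n : good n (G n).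
  elim: n => [|n IH] /=; last by have [] := HF (n, G n) IH.
  split; [exact: cst_continuous|by []|].
  rewrite D0; apply/seteqP; split=> [_ [t _ <-]//|_ ->]; exists 0 => //.
  by rewrite /= in_itv /= oppr0 lexx.
have agree n m t : - n%:R <= t <= n%:R -> G (n + m)%N t = G n t.
  move=> tn; elim: m => [|m IH]; first by rewrite addn0.
  have nm : (n%:R : R) <= (n + m)%:R by rewrite ler_nat leq_addr.
  have [_ FE] := HF ((n + m)%N, G (n + m)%N) (goodG (n + m)%N).
  case/andP: tn => t1 t2; rewrite addnS /= FE //=.
  by rewrite (le_trans t2 nm) andbT (le_trans _ t1)// lerN2.
(* Any stage whose interval contains [t] gives the same value by [agree]; this one contains [t] in
   its interior, which yields continuity. *)
pose psi t := G (Num.truncn `|t|).+1 t.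
have psiE n t : - n%:R <= t <= n%:R -> psi t = G n t.
  move=> tn; have tt : - (Num.truncn `|t|).+1%:R <= t <= (Num.truncn `|t|).+1%:R.
    by rewrite -ler_norml ltW// truncnS_gt.
  rewrite /psi; have [nt|tn'] := leqP n (Num.truncn `|t|).+1.
    by rewrite -(subnKC nt) agree.
  by rewrite -(subnKC (ltnW tn')) agree.
exists psi; split.
- move=> t; pose n := (Num.truncn `|t|).+1.
  have tn : `|t| < n%:R by exact: truncnS_gt.
  have [cG _ _] := goodG n.
  move=> U /= Ut; rewrite nbhs_simpl /=.
  have /andP[t1 t2] : - n%:R < t < n%:R by rewrite -ltr_norml.
  rewrite (psiE n) in Ut; last by rewrite !ltW.
  have h1 : \forall s \near t, U (G n s) by exact: (cG t U Ut).
  apply: filterS3 h1 (lt_nbhsl t2) (lt_nbhsr t1) => s Us s1 s2 /=.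
  by rewrite (psiE n)// !ltW.
- move=> n; have [_ _ <-] := goodG n.
  by apply: eq_imagel => t; rewrite /= in_itv /= => /psiE.
- move=> n; have [_ /convex_fibersP CG _] := goodG n.
  apply/convex_fibersP => s t u ns st tu un.
  by rewrite !(psiE n); [exact: CG|lra..].
Qed.

End composant_line.

(** * A dense half-line in the indecomposable case *)

Section indecomposable.
Context {R : realType} {X : metricType R}.
Hypothesis aX : arc_continuum X.
Hypothesis indec : forall A B : set X, subcontinuum A -> subcontinuum B ->
  A <> [set: X] -> B <> [set: X] -> A `|` B <> [set: X].

Lemma closure_metricP (A : set X) : closure A = [set: X] ->
  forall x (e : R), 0 < e -> exists2 y, A y & mdist x y < e.
Proof.
move=> AT x e e0; have : closure A x by rewrite AT.
by move=> /(_ _ (nbhsx_ballx x e e0))[y [Ay /ball_mdist]]; exists y.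
Qed.

Lemma indecomposable_ray : exists phi : R -> X, lifting_ray phi.
Proof.
have [[cX kX X2] _] := aX; have [p _] := X2.
have [D [D0 HD DS cofD]] := composant_chain cX X2 p indec.
have [psi [cpsi psiD Cpsi]] := composant_line aX D0 HD DS.
have Dle m n : (m <= n)%N -> D m `<=` D n.
  move=> /subnKC <-; elim: (n - m)%N => [|k IH]; first by rewrite addn0.
  by rewrite addnS => x /IH/DS.
have bound (t : R) : exists n : nat, `|t| <= n%:R.
  by exists (Num.truncn `|t|).+1; rewrite ltW// truncnS_gt.
(* [A] meets [D N] in [psi t], so their union is a subcontinuum through [p], proper by [indec], and
   thus lies in some [D m]. Lifting then takes place inside one bounded window. *)
have absorb A (t : R) : subcontinuum A -> A <> [set: X] -> A (psi t) ->
    forall s : R, exists n, [/\ A `<=` D n, `|t| <= n%:R & `|s| <= n%:R].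
  move=> sA AT At s; have [n1 tn] := bound t; have [n2 sn] := bound s.
  pose N := (n1 + n2)%N; have [sD Dp DT] := HD N.
  have tN : `|t| <= N%:R by apply: le_trans tn _; rewrite ler_nat leq_addr.
  have sN : `|s| <= N%:R by apply: le_trans sn _; rewrite ler_nat leq_addl.
  have DN : D N (psi t).
    by rewrite -psiD; exists t => //=; rewrite in_itv /= -ler_norml.
  have [||m mD] := cofD (A `|` D N) _ _ (indec sA sD AT DT).
  - by apply: subcontinuumU => //; exists (psi t).
  - by right.
  exists (m + N)%N; split.
  - by move=> x Ax; apply: (Dle m); [exact: leq_addr|apply: mD; left].
  - by apply: le_trans tN _; rewrite ler_nat leq_addl.
  - by apply: le_trans sN _; rewrite ler_nat leq_addl.
have lift a b A : a <= b -> subcontinuum A -> A <> [set: X] ->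
    (forall t, a <= t <= b -> A (psi t)) ->
    exists c d, [/\ c <= a, b <= d, forall t, c <= t <= d -> A (psi t) &
      A `<=` psi @` `[c, d]%classic].
  move=> ab sA AT Aab.
  have [n [AD]] : exists n, [/\ A `<=` D n, `|a| <= n%:R & `|b| <= n%:R].
    by apply: absorb => //; apply: Aab; rewrite lexx ab.
  rewrite !ler_norml => /andP[na an] /andP[nb bn]; rewrite -psiD in AD.
  have [_ _ kA] := sA.
  have [c [d [/andP[_ ca] /andP[bd _] H1 H2]]] := lift_continuum cpsi sA AD
    (fun s t u ns st tu un => convex_preimage cpsi kA AD (Cpsi n A) ns st tu un)
    na ab bn Aab.
  by exists c, d.
have dense_psi : closure (range psi) = [set: X].
  apply/seteqP; split=> // x _ U; rewrite -nbhs_ballE => -[e /= e0 eU].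
  have [A [sA Ap AT [y Ay xy]]] := composant_dense cX kX X2 p x e0.
  have [n An] := cofD A sA Ap AT; have := An y Ay; rewrite -psiD => -[t _ ty].
  by exists (psi t); split; [exists t|apply/eU/ball_mdist; rewrite ty].
pose Rt T := closure (psi @` `[T, +oo[%classic).
pose Lt T := closure (psi @` `]-oo, T]%classic).
have sub_closure (i : interval R) x : [set` i] x ->
    subcontinuum (closure (psi @` [set` i])).
  move=> ix; apply/(subcontinuumP _ cX); split.
  - by exists (psi x); apply: subset_closure; exists x.
  - exact: closed_closure.
  - apply: connected_closure; apply: connected_continuous_connected.
      by apply/connected_intervalP; exact: interval_is_interval.
    exact: continuous_subspaceT.
have [RT|/existsNP[T0 RT0]] := pselect (forall T, Rt T = [set: X]).
  exists psi; split=> // x e T e0.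
  have [_ [t + <-] xt] := closure_metricP (RT T) x e0.
  by rewrite /= in_itv /= andbT; exists t.
(* If a left tail also had a proper closure, [X] would be the union of that closure with the closure
   of the right tail at [T0], the latter joined to the bridge [M] between [T] and [T0]. [M] lies in
   some [D n] and is proper, so two uses of [indec] give a contradiction. *)
have LT T : Lt T = [set: X].
  apply: contrapT => LT.
  pose M := psi @` `[Num.min T T0, Num.max T T0]%classic.
  have sM : subcontinuum M.
    by apply: path_image_subcontinuum; rewrite // ge_min le_max lexx.
  have MT : M <> [set: X].
    have [n1 Tn] := bound T; have [n2 T0n] := bound T0.
    have [_ _ DT] := HD (n1 + n2)%N; move=> MT; apply: DT; apply/seteqP; split=> // x _.
    have : M x by rewrite MT.
    move=> [t + <-]; rewrite /= in_itv /= => /andP[t1 t2].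
    rewrite -psiD; exists t => //=; rewrite in_itv /=.
    move: Tn T0n; rewrite !ler_norml natrD => /andP[h1 h2] /andP[h3 h4].
    have := ler0n R n1; have := ler0n R n2 => p2 p1.
    apply/andP; split.
      by apply: le_trans t1; rewrite le_min; apply/andP; split; lra.
    by apply: (le_trans t2); rewrite ge_max; apply/andP; split; lra.
  have inM t : Num.min T T0 <= t <= Num.max T T0 -> M (psi t).
    by move=> tM; exists t => //=; rewrite in_itv.
  have sR : subcontinuum (Rt T0) by apply: (sub_closure _ T0); rewrite /= in_itv /= lexx.
  have sL : subcontinuum (Lt T) by apply: (sub_closure _ T); rewrite /= in_itv /= lexx.
  have sRM : subcontinuum (Rt T0 `|` M).
    apply: subcontinuumU => //; exists (psi T0); split.
      by apply: subset_closure; exists T0 => //; rewrite /= in_itv /= lexx.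
    by apply: inM; rewrite ge_min le_max lexx !orbT.
  apply: (indec sRM sL (indec sR sM RT0 MT) LT).
  apply/seteqP; split=> // x _.
  have : closure (range psi) x by rewrite dense_psi.
  have cRML : closed (Rt T0 `|` M `|` Lt T).
    by apply: closedU; [apply: closedU|]; [exact: closed_closure|exact: path_image_closed|exact: closed_closure].
  rewrite [X in _ -> X x]((closure_id _).1 cRML); apply: closureS => _ [t _ <-].
  have [tT|Tt] := leP t T.
    by right; apply: subset_closure; exists t => //; rewrite /= in_itv.
  left; have [Tt0|tT0] := leP T0 t.
    by left; apply: subset_closure; exists t => //; rewrite /= in_itv /= Tt0.
  by right; apply: inM; rewrite ge_min le_max (ltW Tt) (ltW tT0) orbT.
(* All left tails being dense, the line is read backwards. *)
have cN : continuous (fun t => psi (- t)).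
  by move=> t; apply: continuous_comp; [exact: opp_continuous|exact: cpsi].
exists (fun t => psi (- t)); split=> //.
  move=> x e T e0; have [_ [t + <-] xt] := closure_metricP (LT (- T)) x e0.
  by rewrite /= in_itv /= => tT; exists (- t); [lra|rewrite opprK].
move=> a b A ab sA AT Aab.
have [||c [d [cb ad cdA Acd]]] := lift (- b) (- a) A _ sA AT; first by lra.
  by move=> t tba; rewrite -[t]opprK; apply: Aab; lra.
exists (- d), (- c); split; [by lra|by lra| |].
  by move=> t tcd; apply: cdA; lra.
move=> x /Acd[t]; rewrite /= in_itv /= => tcd tx; exists (- t).
  by rewrite /= in_itv /=; lra.
by rewrite opprK.
Qed.

End indecomposable.

Theorem theorem4p5 (R : realType) (X : metricType R) :
  arc_continuum X -> semi_Kelley X -> semi_Kelley_remainder X.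
Proof.
move=> aX skX.
suff [phi] : exists phi : R -> X, lifting_ray phi.
  exact: lifting_ray_semi_Kelley_remainder.
have [[A [B [sA sB AT BT AB]]]|indec] := pselect (exists A B : set X,
    [/\ subcontinuum A, subcontinuum B, A <> [set: X], B <> [set: X] &
      A `|` B = [set: X]]).
  exact: decomposable_ray AB.
apply: indecomposable_ray => // A B sA sB AT BT AB.
by apply: indec; exists A, B.
Qed.
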